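(* Let $0<\alpha<\beta$ be real numbers. For each integer $n\ge 0$ put $I_n=[-n\alpha-\beta,-n\alpha]\cup[n\alpha,n\alpha+\beta]$. Then the real flow given by the translation $\sigma$ (acting coordinatewise) on the product space $$\prod_{m=0}^{+\infty}\prod_{n=0}^m\left(\mathcal{B}(I_n)\cap L(\mathbb{R})\right)$$ is universal; that is, every real flow $(X,\mathbb{R},T)$ can be embedded in it.
   Context: A real flow $(X,\mathbb{R},T)$ is a compact metric space $X$ with a continuous map $T:\mathbb{R}\times X\to X$, $(t,x)\mapsto T_tx$, with $T_0x=x$ and $T_{r+s}x=T_rT_sx$. A flow $(Y,\mathbb{R},S)$ can be embedded in $(X,\mathbb{R},T)$ if there is a homeomorphism $\phi$ of $Y$ into $X$ (onto its image) with $\phi(S_ty)=T_t\phi(y)$ for all $t\in\mathbb{R}$, $y\in Y$. A real flow is universal if all real flows can be embedded in it. Function spaces on $\mathbb{R}$ carry the topology of uniform convergence on compact subsets, given by $D(f,g)=\sum_{n\ge1}2^{-n}\|f-g\|_{L^\infty([-n,n])}$. The translation is $\sigma_t f=f(\cdot+t)$. Products carry the product topology, and $\mathbb{R}$ acts on them by translating every coordinate. For compact $I\subset\mathbb{R}$, a bounded continuous $f:\mathbb{R}\to\mathbb{C}$ is band-limited in $I$ if $\mathrm{supp}(\mathcal{F}(f))\subset I$, where $\mathcal{F}(f)$ is the Fourier transform of $f$ as a tempered distribution (extending $\mathcal{F}(f)(\xi)=\int_{\mathbb{R}}e^{-2\pi\sqrt{-1}t\xi}f(t)\,dt$); i.e.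 $\langle\mathcal{F}(f),g\rangle=0$ for all rapidly decreasing (Schwartz) $g:\mathbb{R}\to\mathbb{C}$ with $\mathrm{supp}(g)\cap I=\emptyset$. $\mathcal{B}(I)$ is the set of continuous $f:\mathbb{R}\to\mathbb{R}$ band-limited in $I$ with $\|f\|_{L^\infty(\mathbb{R})}\le1$; it is compact and translation invariant. $L(\mathbb{R})$ is the set of functions $f:\mathbb{R}\to[-1,1]$ with $|f(s)-f(t)|\le|s-t|$ for all $s,t\in\mathbb{R}$; it is compact and translation invariant. *)

(* Defs.v *)
From HB Require Import structures.
From mathcomp Require Import all_boot all_order all_algebra.
From mathcomp Require Import complex.
From mathcomp Require Import all_classical all_reals all_analysis.

Set Implicit Arguments.
Unset Strict Implicit.
Unset Printing Implicit Defensive.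

Import Order.TTheory GRing.Theory Num.Theory.
Import numFieldNormedType.Exports.

Local Open Scope classical_set_scope.
Local Open Scope ring_scope.
Local Open Scope complex_scope.

Definition metrizable (R : realType) (X : topologicalType) : Prop :=
  exists d : X -> X -> R,
    [/\ forall x, d x x = 0,
        forall x y, d x y = 0 -> x = y,
        forall x y, d x y = d y x,
        forall x y z, d x z <= d x y + d y z
      & forall x : X, nbhs x =
          filter_from [set e : R | 0 < e] (fun e => [set y | d x y < e])].

(* Being a flow, and embedding of flows, depend on the metric only through
   its topology; the metric of the phase space is therefore not fixed. *)
Definition real_flow (R : realType) (X : topologicalType)
    (T : R -> X -> X) : Prop :=
  [/\ metrizable R X,
      compact [set: X],
      continuous (fun p : R * X => T p.1 p.2),
      forall x, T 0 x = x
    & forall r s x, T (r + s) x = T r (T s x)].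

(* The image [range phi] carries the subspace topology of [set_type]. *)
Definition homeomorphism_onto_image (Y X : topologicalType)
    (phi : Y -> X) : Prop :=
  [/\ continuous phi, injective phi
    & exists2 psi : set_type (range phi) -> Y,
        continuous psi & forall z, phi (psi z) = \val z].

Definition flow_embeds (R : realType) (Y X : topologicalType)
    (S : R -> Y -> Y) (T : R -> X -> X) : Prop :=
  exists2 phi : Y -> X, homeomorphism_onto_image phi &
    forall t y, phi (S t y) = T t (phi y).

Definition universal_flow (R : realType) (X : topologicalType)
    (T : R -> X -> X) : Prop :=
  real_flow T /\
  forall (Y : topologicalType) (S : R -> Y -> Y),
    real_flow S -> flow_embeds S T.

Definition schwartz_real (R : realType) (u : R -> R) : Prop :=
  (forall n t, derivable (derive1n n u) t 1) /\
  (forall k n : nat, exists C : R, forall t, `|t| ^+ k * `|derive1n n u t| <= C).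

Definition schwartz (R : realType) (g : R -> R[i]) : Prop :=
  schwartz_real (fun t => complex.Re (g t)) /\
  schwartz_real (fun t => complex.Im (g t)).

Definition cintegral (R : realType) (h : R -> R[i]) : R[i] :=
  (\int[@lebesgue_measure R]_t complex.Re (h t))%R
  +i* (\int[@lebesgue_measure R]_t complex.Im (h t))%R.

(* [cos a -i* sin a] is exp (- i a). *)
Definition fourier (R : realType) (g : R -> R[i]) (xi : R) : R[i] :=
  cintegral (fun t => (cos (2 * pi * t * xi) -i* sin (2 * pi * t * xi)) * g t).

(* <F(f), g> := <f, F(g)>, bilinear (no conjugation), for f bounded and
   continuous. *)
Definition fourier_distribution (R : realType) (f g : R -> R[i]) : R[i] :=
  cintegral (fun t => f t * fourier g t).

(* Meant for bounded continuous f. *)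
Definition band_limited (R : realType) (I : set R) (f : R -> R[i]) : Prop :=
  forall g : R -> R[i], schwartz g ->
    closure [set t | g t != 0] `&` I = set0 ->
    fourier_distribution f g = 0.

Definition band_limited_ball (R : realType) (I : set R) :
    set {family compact, R -> R} :=
  [set f : R -> R | [/\ continuous f,
      band_limited I (fun t => (f t)%:C)
    & (Lnorm (@lebesgue_measure R) +oo (fun t => (f t)%:E) <= 1)%E]].

Definition lipschitz_ball (R : realType) : set {family compact, R -> R} :=
  [set f : R -> R | (forall t, -1 <= f t <= 1) /\
    (forall s t, `|f s - f t| <= `|s - t|)].

Definition translate (R : realType) (t : R) (f : R -> R) : R -> R :=
  fun s => f (s + t).

Definition band (R : realType) (alpha beta : R) (n : nat) : set R :=
  `[- (n%:R * alpha) - beta, - (n%:R * alpha)] `|`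
  `[n%:R * alpha, n%:R * alpha + beta].

Definition band_space (R : realType) (alpha beta : R) (n : nat) :
    topologicalType :=
  set_type (band_limited_ball (band alpha beta n) `&` @lipschitz_ball R).

Definition band_product (R : realType) (alpha beta : R) : topologicalType :=
  prod_topology (fun m : nat =>
    prod_topology (fun n : 'I_m.+1 => band_space alpha beta n)).

(* Main.v *)
From HB Require Import structures.
From mathcomp Require Import all_boot all_order all_algebra.
From mathcomp Require Import complex ring lra.
From mathcomp Require Import all_classical all_reals all_analysis.
From mathcomp Require Import measurable_realfun ess_sup_inf.
Require Import Defs.

Set Implicit Arguments.
Unset Strict Implicit.
Unset Printing Implicit Defensive.

Import Order.TTheory GRing.Theory Num.Theory.
Import numFieldNormedType.Exports.

Local Open Scope classical_set_scope.
Local Open Scope ring_scope.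

(** Let (Y, S) be a flow and g a continuous function on Y which is Lipschitz
    along orbits; such functions separate the points of Y. With the Fejér-type
    kernel K(x) = (1 - cos (a x)) / x^2, the function
      t |-> int g(S_(t+s) y) K(s) cos (k a s) ds
    is Lipschitz, and its spectrum lies in the tent of half-width a centred at
    +-k a: since int (1 - cos (b x)) / x^2 dx is proportional to |b|, the
    Fourier transform of K is a second difference of |.|, hence a tent. For
    a = pi (beta - alpha), that is for frequencies in a window of width
    beta - alpha, every such tent fits into one of the bands I_n; and I_n
    occurs infinitely often in the product, so that all these functions can be
    given a coordinate. Conversely, 1 - cos (N t) is 1 - cos t times a
    combination of the cos (k t), k < N, so the coordinates at time 0
    determine int g(S_s y) (1 - cos (N a s)) / s^2 ds for all N, and hence,
    rescaling s and letting N tend to infinity, the value g(y). *)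

(** * Integration on the real line *)

(** A function t -> g(S_t y) is merely bounded, so its Fourier transform is only a distribution and
    cannot be cut into pieces directly. Every spectral statement is therefore moved by Fubini onto
    the kernel, which is absolutely integrable and has compact spectrum. The width [beta - alpha]
    comes from the bands: on the positive half-line they have length [beta] and start [alpha] apart,
    so neighbours overlap by [beta - alpha], and an interval of that length fits into the last band
    starting at or before its left end. The centres of the tents are spaced by exactly their
    half-width, because 1 - cos (N t) = (1 - cos t) (N + 2 sum_(0 < k < N) (N - k) cos (k t)):
    weighted neighbours add up to arbitrarily wide tents. The Lipschitz condition makes each factor
    equicontinuous, hence compact by Ascoli, with its topology governed by evaluations. As the phase
    space is compact too, a continuous equivariant injection is already an embedding. *)

Section lebesgue_real.
Variable R : realType.
Local Notation mu := (@lebesgue_measure R).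

Lemma measurable_affine (a b : R) :
  measurable_fun [set: measurableTypeR R]
    (fun x : measurableTypeR R => a * x + b : measurableTypeR R).
Proof.
apply: continuous_measurable_fun => x.
by apply: cvgD; [apply: cvgM; [exact: cvg_cst|exact: cvg_id]|exact: cvg_cst].
Qed.

(** The right-hand side is a measure agreeing with Lebesgue measure on half-open intervals, which
    determine it. For negative [a] the preimage of such an interval is closed at the opposite end,
    hence the case distinction. *)
Lemma lebesgue_measure_affine (a b : R) (A : set (measurableTypeR R)) :
  a != 0 -> measurable A ->
  mu A = (`|a|%:E *
    pushforward mu (fun x : measurableTypeR R => (a * x + b)%R : measurableTypeR R) A)%E.
Proof.
move=> a0 mA.
pose mf := @measurable_affine a b.
pose mf_mixin := isMeasurableFun.Build _ _ _ _ _ mf.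
pose f : {mfun _ >-> _} :=
  HB.pack (fun x : measurableTypeR R => a * x + b : measurableTypeR R) mf_mixin.
have := @lebesgue_measure_unique R (mscale (NngNum (normr_ge0 a)) (pushforward mu f)).
apply => // _ [[u v]] _ <- /=.
rewrite /mscale /pushforward/= !lebesgue_measure_itv/= lte_fin.
have pre : (fun x => a * x + b) @^-1` `]u, v] =
   [set` if 0 < a then `] (u - b) / a, (v - b)/a] else `[(v - b) / a, (u - b)/ a[] :> set R.
  case: ifPn => ha; apply/seteqP; split => x /=; rewrite !in_itv/=.
  - by rewrite ltr_pdivrMr// ler_pdivlMr// mulrC ltrBlDr lerBrDr.
  - by rewrite ltr_pdivrMr// ler_pdivlMr// mulrC ltrBlDr lerBrDr.
  - have {}ha : a < 0 by rewrite lt_neqAle a0 leNgt.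
    by rewrite ltr_ndivlMr// ler_ndivrMr// mulrC ltrBlDr lerBrDr andbC.
  - have {}ha : a < 0 by rewrite lt_neqAle a0 leNgt.
    by rewrite ltr_ndivlMr// ler_ndivrMr// mulrC ltrBlDr lerBrDr andbC.
rewrite [X in (_ * lebesgue_measure X)%E]pre.
have [ha|ha] := ltP 0 a; rewrite lebesgue_measure_itv/= lte_fin.
  rewrite ltr_pM2r ?invr_gt0// ltrD2r; case: ifPn => uv; last by rewrite mule0.
  by rewrite -!EFinB -EFinM gtr0_norm//; congr EFin; field.
have {}ha : a < 0 by rewrite lt_neqAle a0.
rewrite ltr_nM2r ?invr_lt0// ltrD2r; case: ifPn => uv; last by rewrite mule0.
by rewrite -!EFinB -EFinM ltr0_norm//; congr EFin; field.
Qed.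

Lemma ge0_integral_affine (a b : R) (g : R -> \bar R) :
  a != 0 -> measurable_fun [set: R] g -> (forall x, 0 <= g x)%E ->
  (\int[mu]_x g (a * x + b)%R = (`|a|^-1)%:E * \int[mu]_x g x)%E.
Proof.
move=> a0 mg g0.
pose mf := @measurable_affine a b.
pose mf_mixin := isMeasurableFun.Build _ _ _ _ _ mf.
pose f : {mfun _ >-> _} :=
  HB.pack (fun x : measurableTypeR R => a * x + b : measurableTypeR R) mf_mixin.
transitivity (\int[pushforward mu f]_x g x)%E.
  by rewrite ge0_integral_pushforward.
rewrite [in RHS](eq_measure_integral (mscale (NngNum (normr_ge0 a)) (pushforward mu f))).
  rewrite ge0_integral_mscale// muleA -EFinM mulVf ?normr_eq0// mul1e//.
by move=> A mA _; exact: (@lebesgue_measure_affine a b).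
Qed.

Definition L1 (f : R -> R) := mu.-integrable [set: R] (EFin \o f).

Lemma L1_measurable f : L1 f -> measurable_fun [set: R] f.
Proof. by move=> /integrableP[/measurable_EFinP]. Qed.

Lemma L1P (f : R -> R) : measurable_fun [set: R] f ->
  (\int[mu]_x (`|f x|)%:E < +oo)%E -> L1 f.
Proof. by move=> mf fi; apply/integrableP; split => //; exact/measurable_EFinP. Qed.

Lemma L1_affine (a b : R) (f : R -> R) : a != 0 -> L1 f ->
  L1 (fun x => f (a * x + b)).
Proof.
move=> a0 Lf; apply: L1P.
  apply: (measurableT_comp (L1_measurable Lf)); exact: measurable_affine.
rewrite (@ge0_integral_affine a b (fun x => (`|f x|)%:E)) //.
- rewrite lte_mul_pinfty ?lee_fin//.
  by move/integrableP : Lf => [].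
- apply/measurable_EFinP/measurableT_comp => //; exact: L1_measurable.
Qed.

Lemma Rintegral_affine (a b : R) (f : R -> R) : a != 0 -> L1 f ->
  \int[mu]_x f (a * x + b) = `|a|^-1 * \int[mu]_x f x.
Proof.
move=> a0 Lf; have mf := L1_measurable Lf.
have mE : measurable_fun [set: R] (EFin \o f) by exact/measurable_EFinP.
rewrite /Rintegral.
rewrite [X in fine X = _]integralE [in RHS]integralE.
rewrite (_ : (fun x => (f (a * x + b))%:E)^\+%E =
  fun x => ((EFin \o f)^\+%E (a * x + b))); last first.
  by apply/funext => x; rewrite ?funeposE ?funenegE.
rewrite (_ : (fun x => (f (a * x + b))%:E)^\-%E =
  fun x => ((EFin \o f)^\-%E (a * x + b))); last first.
  by apply/funext => x; rewrite ?funeposE ?funenegE.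
rewrite ge0_integral_affine//; [|exact: measurable_funepos].
rewrite ge0_integral_affine//; [|exact: measurable_funeneg].
have pf := integrable_pos_fin_num measurableT Lf.
have nf := integrable_neg_fin_num measurableT Lf.
move: pf nf; set p := (X in X \is a fin_num -> _); set n := (\int[_]_x _)%E => pf nf.
by rewrite -muleBr ?fin_num_adde_defr// fineM// fin_numB pf nf.
Qed.

End lebesgue_real.

Section L1_tools.
Variable R : realType.
Local Notation mu := (@lebesgue_measure R).
Implicit Types f g : R -> R.

Lemma L1_le f g : measurable_fun [set: R] f -> L1 g ->
  (forall x, `|f x| <= g x) -> L1 f.
Proof.
move=> mf Lg fg; apply: (le_integrable measurableT _ _ Lg).
  exact/measurable_EFinP.
by move=> x _ /=; rewrite lee_fin (le_trans (fg x))// ler_norm.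
Qed.

Lemma L1D f g : L1 f -> L1 g -> L1 (fun x => f x + g x).
Proof. by move=> Lf Lg; exact: (integrableD measurableT Lf Lg). Qed.

Lemma L1Z (r : R) f : L1 f -> L1 (fun x => r * f x).
Proof. by move=> Lf; exact: (integrableZl measurableT r Lf). Qed.

Lemma L1B f g : L1 f -> L1 g -> L1 (fun x => f x - g x).
Proof. by move=> Lf Lg; exact: (integrableB measurableT Lf Lg). Qed.

Lemma L1_norm f : L1 f -> L1 (fun x => `|f x|).
Proof. by move=> Lf; exact: (integrable_abse Lf). Qed.

Lemma L1Ml_bounded f g (C : R) : measurable_fun [set: R] f ->
  (forall x, `|f x| <= C) -> L1 g -> L1 (fun x => f x * g x).
Proof.
move=> mf fC Lg; apply: (@L1_le _ (fun x => C * `|g x|)).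
- by apply: measurable_funM => //; exact: L1_measurable.
- exact/L1Z/L1_norm.
- by move=> x; rewrite normrM ler_wpM2r.
Qed.

Lemma le_Rint f g : L1 f -> L1 g -> (forall x, f x <= g x) ->
  \int[mu]_x f x <= \int[mu]_x g x.
Proof. by move=> Lf Lg fg; apply: le_Rintegral. Qed.

Lemma norm_Rint_le f g : L1 f -> L1 g -> (forall x, `|f x| <= g x) ->
  `|\int[mu]_x f x| <= \int[mu]_x g x.
Proof.
move=> Lf Lg fg; apply: (le_trans (le_normr_Rintegral measurableT Lf)).
by apply: le_Rint => //; exact: L1_norm.
Qed.

Lemma Rint_dominated_cvg (f_ : (R -> R)^nat) f g :
  (forall n, measurable_fun [set: R] (f_ n)) ->
  (forall x, f_ ^~ x @ \oo --> f x) ->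
  L1 g -> (forall n x, `|f_ n x| <= g x) ->
  \int[mu]_x f_ n x @[n --> \oo] --> \int[mu]_x f x.
Proof.
move=> mf_ f_f Lg f_g.
have mf : measurable_fun [set: R] f.
  by apply: (measurable_fun_cvg mf_) => x _; exact: f_f.
have LE n : L1 (f_ n) by exact: (L1_le (mf_ n) Lg (f_g n)).
have f_fE x : (f_ n x)%:E @[n --> \oo] --> (f x)%:E.
  by apply/fine_cvgP; split; [exact: nearW|exact: f_f].
have [] := @dominated_convergence _ _ R mu _ measurableT
  (fun n => EFin \o f_ n) (EFin \o f) (EFin \o g).
- by move=> n; have /measurable_EFinP := mf_ n.
- by have /measurable_EFinP := mf.
- by apply: aeW => x _; exact: f_fE.
- exact: Lg.
- by apply: aeW => x n _; exact: f_g.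
move=> Lf _ H.
apply: fine_cvg; rewrite fineK; last exact: (integrable_fin_num measurableT Lf).
exact: H.
Qed.

Lemma L1_oneDsqrV : L1 (fun x : R => (oneDsqr x)^-1).
Proof.
have cV := @continuous_oneDsqrV R.
apply: L1P; first exact: continuous_measurable_fun.
under eq_integral do rewrite ger0_norm ?invr_ge0 ?(le_trans ler01 (oneDsqr_ge1 _))//.
rewrite ge0_symfun_integralT => [|x|//|x]; last first.
- by rewrite /= /oneDsqr sqrrN.
- by rewrite invr_ge0 (le_trans ler01 (oneDsqr_ge1 _)).
have -> : [set x : R | (0 <= x)%R] = `[0, +oo[%classic.
  by apply/seteqP; split => x /=; rewrite in_itv/= andbT.
by rewrite integral0y_oneDsqr -EFinM ltry.
Qed.

(** Fubini for real-valued integrals. The majorant [M] of the inner absolute integrals gives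
    integrability on the plane by Tonelli; integrability of every section makes each inner integral
    finite, so that [fine] loses nothing. *)
Lemma Rint_swap (F : R * R -> R) (M : R -> R) :
  measurable_fun [set: R * R] F ->
  (forall x, (\int[mu]_y (`|F (x, y)|)%:E <= (M x)%:E)%E) -> L1 M ->
  (forall y, L1 (fun x => F (x, y))) ->
  L1 (fun x => \int[mu]_y F (x, y)) /\
  \int[mu]_x \int[mu]_y F (x, y) = \int[mu]_y \int[mu]_x F (x, y).
Proof.
move=> mF FM LM LF.
have mE : measurable_fun [set: R * R] (EFin \o F) by exact/measurable_EFinP.
have LFx x : L1 (fun y => F (x, y)).
  apply: L1P; first exact: measurable_fun_pair2.
  by apply: (le_lt_trans (FM x)); rewrite ltry.
have IF : (product_measure1 mu mu).-integrable [set: R * R] (EFin \o F).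
  apply/integrable12ltyP => //.
  apply: (@le_lt_trans _ _ (\int[mu]_x (`|M x|)%:E)%E).
    apply: ge0_le_integral => //.
    - by move=> x _; apply: integral_ge0.
    - have := @measurable_fun_fubini_tonelli_F _ _ _ _ R mu (abse \o (EFin \o F)).
      by apply=> //=; exact: measurableT_comp.
    - apply/measurable_EFinP/measurableT_comp => //; exact: L1_measurable.
    - by move=> x _; apply: (le_trans (FM x)); rewrite lee_fin ler_norm.
  by move/integrableP : LM => [].
have E1 x : (\int[mu]_y F (x, y))%:E = (\int[mu]_y (F (x, y))%:E)%E.
  by rewrite fineK//; exact: (integrable_fin_num measurableT (LFx x)).
have E2 y : (\int[mu]_x F (x, y))%:E = (\int[mu]_x (F (x, y))%:E)%E.
  by rewrite fineK//; exact: (integrable_fin_num measurableT (LF y)).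
split.
  have := integrable_fubini_F IF.
  by apply: eq_integrable => // x _ /=; rewrite E1.
rewrite /Rintegral; congr fine.
under eq_integral do rewrite E1.
under [in RHS]eq_integral do rewrite E2.
exact: (Fubini IF).
Qed.

Lemma FTC_line (F f : R -> R) : (forall x : R, is_derive x (1 : R) F (f x)) ->
  continuous f -> L1 f ->
  F n%:R @[n --> \oo] --> 0 -> F (- n%:R) @[n --> \oo] --> 0 ->
  \int[mu]_x f x = 0.
Proof.
move=> dF cf Lf Fp Fn.
pose f_ n := f \_ `[- n%:R, n%:R]%classic.
(* The index [n.+1] keeps the interval nondegenerate, as the fundamental theorem on a segment
   requires. *)
have H n : \int[mu]_x f_ n.+1 x = F n.+1%:R - F (- n.+1%:R).
  have n0 : - n.+1%:R < n.+1%:R :> R.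
    by rewrite -subr_gt0 opprK addr_gt0.
  have cF : continuous F.
    by move=> x; apply: differentiable_continuous; apply/derivable1_diffP; case: (dF x).
  rewrite -Rintegral_mkcond /Rintegral (@continuous_FTC2 _ f F)//.
  - exact: continuous_subspaceT.
  - split; first by move=> x _; case: (dF x).
    + by apply: cvg_at_right_filter; exact: cF.
    + by apply: cvg_at_left_filter; exact: cF.
  - by move=> x _; rewrite derive1E; case: (dF x).
have C1 : \int[mu]_x f_ n.+1 x @[n --> \oo] --> \int[mu]_x f x.
  apply: (@Rint_dominated_cvg (fun n => f_ n.+1) f (fun x => `|f x|)).
  - move=> n; apply/(measurable_restrictT _ _).1 => //.
    exact: measurable_funTS (L1_measurable Lf).
  - move=> x; apply: cvg_near_cst.
    near=> n; rewrite /f_ patchE mem_set//= in_itv/=.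
    rewrite -ler_norml.
    apply: (@le_trans _ _ n%:R); last by rewrite ler_nat.
    near: n; exact: nbhs_infty_ger.
  - exact: L1_norm.
  - by move=> n x; rewrite /f_ patchE; case: ifP => // _; rewrite normr0.
have C2 : F n.+1%:R - F (- n.+1%:R) @[n --> \oo] --> 0 - 0.
  apply: cvgB.
  - by rewrite (cvg_shiftS (fun n => F n%:R)).
  - by rewrite (cvg_shiftS (fun n => F (- n%:R))).
have E : (fun n => \int[mu]_x f_ n.+1 x) = (fun n => F n.+1%:R - F (- n.+1%:R)).
  by apply/funext => n; rewrite H.
rewrite E in C1.
by rewrite -(cvg_lim _ C1)// (cvg_lim _ C2)// subr0.
Unshelve. all: by end_near. Qed.
End L1_tools.

(** * The Fejér kernel *)

Section fejer.
Variable R : realType.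
Local Notation mu := (@lebesgue_measure R).

Lemma norm_sin_le (x : R) : `|sin x| <= `|x|.
Proof.
wlog x0 : x / 0 <= x.
  move=> H; have [/H//|/ltW x0] := leP 0 x.
  by rewrite -normrN -sinN -[leRHS]normrN H// oppr_ge0.
have [c _] := @MVT_segment R sin cos 0 x x0 (fun x _ => is_derive_sin x)
  (continuous_subspaceT (@continuous_sin R)).
rewrite sin0 !subr0 => ->; rewrite normrM -[leRHS]mul1r ler_wpM2r//.
exact: cos_max.
Qed.

Lemma cos_half_angle (x : R) : 1 - cos x = sin (x / 2) ^+ 2 *+ 2.
Proof.
have -> : cos x = cos ((x / 2) *+ 2) by congr cos; rewrite -mulr_natr divfK.
rewrite cos_mulr2n cos2sin2; ring.
Qed.

Lemma onem_cos_ge0 (x : R) : 0 <= 1 - cos x.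
Proof. by rewrite subr_ge0 cos_le1. Qed.

Lemma onem_cos_le2 (x : R) : 1 - cos x <= 2.
Proof. have := cos_geN1 x; lra. Qed.

Lemma onem_cos_le_sqr (x : R) : 1 - cos x <= x ^+ 2.
Proof.
rewrite cos_half_angle.
have := norm_sin_le (x / 2); rewrite -ler_sqr ?nnegrE// !real_normK ?num_real//.
rewrite exprMn exprVn; nra.
Qed.

(* At x = 0 division by 0 gives 0 instead of a^2 / 2; only integrals of fejer
   matter. *)
Definition fejer (a x : R) : R := (1 - cos (a * x)) / x ^+ 2.

Lemma fejer_ge0 a x : 0 <= fejer a x.
Proof. by rewrite /fejer divr_ge0 ?onem_cos_ge0 ?sqr_ge0. Qed.

(** Multiplied by 1 + x^2, the kernel becomes (1 - cos (a x)) / x^2 + (1 - cos (a x)); the first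
    term is at most a^2, the second at most 2. *)
Lemma fejer_le a x : fejer a x <= (a ^+ 2 + 2) * (oneDsqr x)^-1.
Proof.
rewrite /fejer ler_pdivlMr ?(lt_le_trans ltr01 (oneDsqr_ge1 x))// /oneDsqr.
have [->|x0] := eqVneq x 0.
  rewrite expr0n/= invr0 !mulr0 mul0r; have := sqr_ge0 a; lra.
have x2 : 0 < x ^+ 2 by rewrite exprn_even_gt0.
rewrite mulrDr mulr1 divfK ?gt_eqF// lerD ?onem_cos_le2//.
by rewrite ler_pdivrMr// -exprMn onem_cos_le_sqr.
Qed.

Lemma measurable_cosM (a : R) : measurable_fun [set: R] (fun x : R => cos (a * x)).
Proof.
apply: continuous_measurable_fun => x.
apply: continuous_comp; last exact: continuous_cos.
by apply: cvgM; [exact: cvg_cst|exact: cvg_id].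
Qed.

Lemma measurable_sinM (a : R) : measurable_fun [set: R] (fun x : R => sin (a * x)).
Proof.
apply: continuous_measurable_fun => x.
apply: continuous_comp; last exact: continuous_sin.
by apply: cvgM; [exact: cvg_cst|exact: cvg_id].
Qed.

Lemma measurable_fejer a : measurable_fun [set: R] (fejer a).
Proof.
(* Continuous approximations with a denominator that never vanishes. At 0 their numerator is 0, so
   they converge there to the default value of [fejer] as well. *)
pose f_ n (x : R) := (1 - cos (a * x)) / (x ^+ 2 + n.+1%:R^-1).
have d0 (n : nat) (x : R) : x ^+ 2 + n.+1%:R^-1 != 0.
  by rewrite gt_eqF// ltr_wpDl ?sqr_ge0.
apply: (@measurable_fun_cvg _ _ R setT f_) => [n|x _].
  apply: continuous_measurable_fun => x; rewrite /f_.
  apply: cvgM.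
    apply: cvgB; first exact: cvg_cst.
    apply: continuous_comp; last exact: continuous_cos.
    by apply: cvgM; [exact: cvg_cst|exact: cvg_id].
  apply: cvgV => //; apply: cvgD; last exact: cvg_cst.
  exact: exprn_continuous.
have [->|x0] := eqVneq x 0.
  rewrite /f_ /fejer mulr0 cos0 subrr mul0r.
  by apply: cvg_near_cst; apply: nearW => n; rewrite mul0r.
apply: cvgM; first exact: cvg_cst.
apply: cvgV; first by rewrite sqrf_eq0.
rewrite -[X in _ --> X]addr0; apply: cvgD; first exact: cvg_cst.
exact: cvg_harmonic.
Qed.

Lemma L1_fejer a : L1 (fejer a).
Proof.
apply: (L1_le (measurable_fejer a) (L1Z (a ^+ 2 + 2) (@L1_oneDsqrV R))) => x.
by rewrite ger0_norm ?fejer_ge0 ?fejer_le.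
Qed.

(* By scaling, so the constant (which is pi) never has to be computed. *)
Lemma Rint_fejer (a : R) : \int[mu]_x fejer a x = `|a| * \int[mu]_x fejer 1 x.
Proof.
have [->|a0] := eqVneq a 0.
  rewrite normr0 mul0r (_ : fejer 0 = fun=> 0 * 0).
    rewrite RintegralZl ?mul0r//; exact: integrable0.
  by apply/funext => x; rewrite /fejer mul0r cos0 subrr !mul0r.
have -> : fejer a = (fun x => a ^+ 2 * fejer 1 (a * x + 0)).
  apply/funext => x; rewrite /fejer mul1r addr0 exprMn [X in _ = _ * (_ * X)]invfM.
  by rewrite [RHS]mulrCA mulVKf// sqrf_eq0.
rewrite RintegralZl//; last exact: (L1_affine 0 a0 (L1_fejer 1)).
rewrite (Rintegral_affine 0 a0 (L1_fejer 1)) mulrA; congr (_ * _).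
by rewrite -(real_normK (num_real a)) expr2 mulfK// normr_eq0.
Qed.

(** On [pi / 2, pi] the cosine is nonpositive, so the kernel is at least 1 / pi^2 there. *)
Lemma Rint_fejer1_gt0 : 0 < \int[mu]_x fejer 1 x.
Proof.
have p0 := pi_gt0 R.
pose g (x : R) : R := (pi ^+ 2)^-1 * \1_(`[pi / 2, pi]%classic : set R) x.
have Lone : L1 (\1_(`[pi / 2, pi]%classic : set R) : R -> R).
  exact: integrable_indic_itv.
suff H : \int[mu]_x g x <= \int[mu]_x fejer 1 x.
  apply: lt_le_trans H.
  rewrite RintegralZl// /Rintegral integral_indic// setIT/= lebesgue_measure_itv/= lte_fin.
  have -> : pi / 2 < pi :> R by lra.
  by rewrite -EFinB/= mulr_gt0 ?invr_gt0 ?exprn_gt0//; lra.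
apply: le_Rint; [exact: L1Z|exact: L1_fejer|] => x.
rewrite /g indicE; case: (boolP (x \in _)) => [|_]; last by rewrite mulr0 fejer_ge0.
rewrite inE/= in_itv/= => /andP[x1 x2]; rewrite mulr1 /fejer mul1r.
have x0 : 0 < x by lra.
have c0 : cos x <= 0.
  rewrite -[x](subrK (pi / 2)) cosDpihalf oppr_le0 sin_ge0_pi//; lra.
rewrite -[leLHS]mul1r ler_pM//; first by rewrite invr_ge0 exprn_ge0 // ltW.
  lra.
rewrite lef_pV2 ?posrE ?exprn_gt0//; nra.
Qed.

Lemma L1_fejer_cos a b : L1 (fun x => cos (b * x) * fejer a x).
Proof.
apply: (@L1Ml_bounded _ _ _ 1 _ _ (L1_fejer a)); first exact: measurable_cosM.
by move=> x; exact: cos_max.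
Qed.

(** Product-to-sum formulas reduce the integral to a multiple of (|xi + a| + |xi - a|) / 2 - |xi|,
    which is 0 outside the support of the tent. *)
Lemma Rint_fejer_cos (a xi : R) : 0 <= a -> a <= `|xi| ->
  \int[mu]_x (cos (xi * x) * fejer a x) = 0.
Proof.
move=> a0 axi.
have E x : cos (xi * x) * fejer a x =
  2^-1 * (fejer (xi + a) x + fejer (xi - a) x) - fejer xi x.
  rewrite /fejer [(xi + a) * x]mulrDl [(xi - a) * x]mulrBl cosD cosB.
  by move: (x ^- 2) => y; field.
have -> : (fun x => cos (xi * x) * fejer a x) =
  (fun x => 2^-1 * (fejer (xi + a) x + fejer (xi - a) x) - fejer xi x).
  exact/funext.
have L2 := L1D (L1_fejer (xi + a)) (L1_fejer (xi - a)).
rewrite RintegralB//; [|exact: L1Z|exact: L1_fejer].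
rewrite RintegralZl// RintegralD//; [|exact: L1_fejer|exact: L1_fejer].
rewrite Rint_fejer (Rint_fejer (_ - _)) (Rint_fejer xi) -mulrDl mulrA -mulrBl.
apply/eqP; rewrite mulf_eq0; apply/orP; left; apply/eqP.
move: axi; rewrite real_ler_normr ?num_real// => /orP[axi|axi].
  by rewrite !ger0_norm; lra.
rewrite !ler0_norm; lra.
Qed.

Lemma Rint_fejer_cos_cos (a b eta : R) : 0 <= a ->
  a <= `|b + eta| -> a <= `|b - eta| ->
  \int[mu]_x (cos (eta * x) * (cos (b * x) * fejer a x)) = 0.
Proof.
move=> a0 h1 h2.
rewrite (_ : (fun x => _) = (fun x => 2^-1 * (cos ((b + eta) * x) * fejer a x +
    cos ((b - eta) * x) * fejer a x))); last first.
  apply/funext => x; rewrite [(b + eta) * x]mulrDl [(b - eta) * x]mulrBl.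
  by rewrite cosD cosB; field.
have L2 := L1D (L1_fejer_cos a (b + eta)) (L1_fejer_cos a (b - eta)).
rewrite RintegralZl// RintegralD//; [|exact: L1_fejer_cos|exact: L1_fejer_cos].
by rewrite !Rint_fejer_cos// addr0 mulr0.
Qed.

Lemma Rint_odd (f : R -> R) : L1 f -> (forall x, f (- x) = - f x) ->
  \int[mu]_x f x = 0.
Proof.
move=> Lf fN; have N10 : -1 != 0 :> R by rewrite oppr_eq0 oner_eq0.
have := Rintegral_affine 0 N10 Lf.
rewrite normrN1 invr1 mul1r (_ : (fun x => f _) = (fun x => -1 * f x)); last first.
  by apply/funext => x; rewrite addr0 [RHS]mulN1r -fN mulN1r.
rewrite RintegralZl//; lra.
Qed.

Lemma Rint_fejer_sin_cos (a b eta : R) :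
  \int[mu]_x (sin (eta * x) * (cos (b * x) * fejer a x)) = 0.
Proof.
apply: Rint_odd.
  apply: (@L1Ml_bounded _ _ _ 1 _ _ (L1_fejer_cos a b)); first exact: measurable_sinM.
  by move=> x; exact: sin_max.
move=> x; rewrite /fejer !mulrN sinN !cosN sqrrN; ring.
Qed.
End fejer.

(** * Recovering a value from integrals against modulated kernels *)

Section separation.
Variable R : realType.
Local Notation mu := (@lebesgue_measure R).
Variables (h : R -> R) (B a : R).
Hypotheses (ch : continuous h) (hB : forall x, `|h x| <= B) (a0 : 0 < a).

Lemma L1_bounded_mul f : L1 f -> L1 (fun x => h x * f x).
Proof. by apply: L1Ml_bounded hB; exact: continuous_measurable_fun. Qed.

Hypothesis h_orth : forall k : nat,
  \int[mu]_x (h x * (cos (k%:R * a * x) * fejer a x)) = 0.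

(* The second difference in N of 1 - cos (N t) is 2 cos ((N + 1) t) (1 - cos t). *)
Lemma fejer_orth (N : nat) : \int[mu]_x (h x * fejer (N%:R * a) x) = 0.
Proof.
suff [] : \int[mu]_x (h x * fejer (N%:R * a) x) = 0 /\
  \int[mu]_x (h x * fejer (N.+1%:R * a) x) = 0 by [].
elim: N => [|N [IH1 IH2]].
  split; last first.
    rewrite -[RHS](h_orth 0); apply: eq_Rintegral => x _.
    by rewrite !mul0r cos0 !mul1r.
  rewrite (_ : (fun x => _) = fun=> 0 * 0).
    rewrite RintegralZl ?mul0r//; exact: integrable0.
  by apply/funext => x; rewrite /fejer !mul0r cos0 subrr !mul0r mulr0.
split => //.
have E x : h x * fejer (N.+2%:R * a) x =
  2 * (h x * fejer (N.+1%:R * a) x + h x * (cos (N.+1%:R * a * x) * fejer a x)) -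
  h x * fejer (N%:R * a) x.
  rewrite /fejer.
  have -> : N.+2%:R * a * x = N.+1%:R * a * x + a * x.
    by rewrite -[in LHS]natr1; ring.
  have -> : N%:R * a * x = N.+1%:R * a * x - a * x.
    by rewrite -natr1; ring.
  rewrite cosD cosB; move: (x ^- 2) => y; ring.
rewrite (_ : (fun x => h x * fejer (N.+2%:R * a) x) = fun x =>
  2 * (h x * fejer (N.+1%:R * a) x + h x * (cos (N.+1%:R * a * x) * fejer a x)) -
  h x * fejer (N%:R * a) x); last exact/funext.
have La b := L1_bounded_mul (L1_fejer b).
have Lb := L1_bounded_mul (L1_fejer_cos a (N.+1%:R * a)).
rewrite RintegralB//; [|exact: (L1Z _ (L1D _ _))|exact: La].
rewrite RintegralZl//; last exact: L1D.
rewrite RintegralD//; last exact: La.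
by rewrite [in X in _ - X]IH1 IH2 h_orth addr0 mulr0 subr0.
Qed.

(** Up to a factor, [fejer (N.+1%:R * a)] is a dilation of [fejer a], so it concentrates at 0.
    Undoing the dilation in the variable leaves a fixed kernel against h (x / (N + 1)), which tends
    to [h 0], and the mass of the kernel is not zero. *)
Lemma fejer_separation : h 0 = 0.
Proof.
have La b := L1_bounded_mul (L1_fejer b).
have Z (N : nat) : \int[mu]_x (h (N.+1%:R^-1 * x) * fejer a x) = 0.
  have N0 : N.+1%:R != 0 :> R by rewrite pnatr_eq0.
  have Ni0 : N.+1%:R^-1 != 0 :> R by rewrite invr_eq0.
  have := Rintegral_affine 0 Ni0 (La (N.+1%:R * a)).
  rewrite fejer_orth mulr0.
  have -> : (fun x => h (N.+1%:R^-1 * x + 0) * fejer (N.+1%:R * a) (N.+1%:R^-1 * x + 0))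
   = (fun x => N.+1%:R ^+ 2 * (h (N.+1%:R^-1 * x) * fejer a x)).
    apply/funext => x; rewrite addr0 /fejer.
    rewrite (_ : N.+1%:R * a * _ = a * x); last by field.
    have -> : (N.+1%:R^-1 * x) ^- 2 = N.+1%:R ^+ 2 * x ^- 2.
      by rewrite exprMn invfM exprVn invrK.
    move: (x ^- 2) => y; ring.
  rewrite RintegralZl//; last first.
    apply: (@L1Ml_bounded _ _ _ B _ _ (L1_fejer a)) => //.
    apply: continuous_measurable_fun => x; apply: continuous_comp; last exact: ch.
    by apply: cvgM; [exact: cvg_cst|exact: cvg_id].
  by move/eqP; rewrite mulf_eq0 sqrf_eq0 (negbTE N0) => /eqP.
have C : \int[mu]_x (h (N.+1%:R^-1 * x) * fejer a x) @[N --> \oo] -->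
         \int[mu]_x (h 0 * fejer a x).
  apply: (@Rint_dominated_cvg _ _ _ (fun x => B * fejer a x)).
  - move=> n; apply: measurable_funM; last exact: measurable_fejer.
    apply: continuous_measurable_fun => x; apply: continuous_comp; last exact: ch.
    by apply: cvgM; [exact: cvg_cst|exact: cvg_id].
  - move=> x; apply: cvgM; last exact: cvg_cst.
    apply: continuous_cvg; first exact: ch.
    rewrite -[X in _ --> X](mul0r x); apply: cvgM; last exact: cvg_cst.
    exact: cvg_harmonic.
  - exact/L1Z/L1_fejer.
  - by move=> n x; rewrite normrM (ger0_norm (fejer_ge0 _ _)) ler_wpM2r ?fejer_ge0.
rewrite (_ : (fun N => _) = fun=> 0) in C; last exact/funext.
have := cvg_lim (@Rhausdorff R) C; rewrite lim_cst//.
rewrite RintegralZl//; last exact: L1_fejer.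
move=> /(_ _)/esym/eqP; rewrite mulf_eq0 Rint_fejer mulf_eq0 normr_eq0 (gt_eqF a0)/=.
by rewrite (gt_eqF (Rint_fejer1_gt0 R)) orbF => /eqP.
Qed.
End separation.

(** * Schwartz functions and band-limited functions *)

Section schwartz_functions.
Variable R : realType.
Local Notation mu := (@lebesgue_measure R).
Implicit Types u v : R -> R.

Lemma derive1nSr n u : derive1n n.+1 u = derive1n n (derive1 u).
Proof. by rewrite /derive1n iterSr. Qed.

Lemma schwartz_derive1 u : schwartz_real u -> schwartz_real (derive1 u).
Proof.
move=> [du bu]; split => [n t|k n].
  by rewrite -derive1nSr; exact: du.
by have [C HC] := bu k n.+1; exists C => t; rewrite -derive1nSr.
Qed.

Lemma schwartz_is_derive u (t : R) : schwartz_real u -> is_derive t (1 : R) u (derive1 u t).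
Proof.
move=> [du _]; have := du 0%N t; rewrite derive1n0 => dut.
by apply: DeriveDef => //; rewrite derive1E.
Qed.

Lemma schwartz_continuous u : schwartz_real u -> continuous u.
Proof.
move=> su t; apply: differentiable_continuous; apply/derivable1_diffP.
by case: (schwartz_is_derive t su).
Qed.

Lemma schwartz_bound u : schwartz_real u ->
  exists2 C, 0 <= C & forall t, `|u t| <= C * (oneDsqr t)^-1.
Proof.
move=> [_ bu]; have [C0 H0] := bu 0%N 0%N; have [C2 H2] := bu 2%N 0%N.
have C00 : 0 <= C0 by apply: le_trans (H0 0); rewrite mulr_ge0.
have C20 : 0 <= C2 by apply: le_trans (H2 0); rewrite mulr_ge0.
exists (C0 + C2); first exact: addr_ge0.
move=> t; rewrite ler_pdivlMr ?(lt_le_trans ltr01 (oneDsqr_ge1 _))// /oneDsqr.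
have := H0 t; have := H2 t; rewrite derive1n0 expr0 mul1r real_normK ?num_real//.
by move=> h2 h0; rewrite mulrDr mulr1 lerD// mulrC.
Qed.

Lemma schwartz_L1 u : schwartz_real u -> L1 u.
Proof.
move=> su; have [C C0 HC] := schwartz_bound su.
apply: (L1_le _ (L1Z C (@L1_oneDsqrV R)) HC).
exact: continuous_measurable_fun (schwartz_continuous su).
Qed.

(** The phase 0 gives the cosine transform and the phase [- (pi / 2)] the sine transform, so one set
    of estimates covers both. *)
Definition phase_transform u (phi xi : R) :=
  \int[mu]_s (cos (2 * pi * xi * s + phi) * u s).

Lemma continuous_affine (b c : R) : continuous (fun x : R => b * x + c).
Proof.
move=> x; apply: cvgD; last exact: cvg_cst.
by apply: cvgM; [exact: cvg_cst|exact: cvg_id].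
Qed.

Lemma continuous_cos_affine (b c : R) : continuous (fun x : R => cos (b * x + c)).
Proof.
move=> x; apply: continuous_comp; last exact: continuous_cos.
exact: continuous_affine.
Qed.

Lemma L1_cos_mul (b c : R) u : L1 u -> L1 (fun s => cos (b * s + c) * u s).
Proof.
move=> Lu; apply: (@L1Ml_bounded _ _ _ 1 _ _ Lu) => [|x]; last exact: cos_max.
exact: continuous_measurable_fun (@continuous_cos_affine b c).
Qed.

(** Made for the boundary terms of [FTC_line]: [w] is a sine or cosine factor, and [e n] is [n] or
    [- n]. *)
Lemma schwartz_cvg0 u w (e : nat -> R) : schwartz_real u ->
  (forall t, `|w t| <= 1) -> (forall n, `|e n| = n%:R) ->
  w (e n) * u (e n) @[n --> \oo] --> (0 : R).
Proof.
move=> su w1 en; have [C C0 HC] := schwartz_bound su.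
apply/norm_cvg0P.
apply: (@squeeze_cvgr _ _ _ _ (fun=> 0) (fun n => C * n.+1%:R^-1)).
- apply: nearW => n; rewrite normr_ge0/=.
  apply: (@le_trans _ _ `|u (e n)|); first by rewrite normrM ler_piMl.
  apply: (le_trans (HC _)); rewrite ler_wpM2l//.
  rewrite lef_pV2 ?posrE// ?(lt_le_trans ltr01 (oneDsqr_ge1 _))//.
  rewrite /oneDsqr -(real_normK (num_real (e n))) en -natrX -nat1r lerD2l ler_nat.
  by case: n => // n; rewrite expnS expn1 leq_pmulr.
- exact: cvg_cst.
- rewrite -[X in _ --> X](mulr0 C); apply: cvgM; first exact: cvg_cst.
  exact: cvg_harmonic.
Qed.

(* Two integrations by parts at once: the integrand is the derivative of
   u' cos + w u sin. *)
Lemma phase_transform_ode u (b c : R) : schwartz_real u ->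
  \int[mu]_s (cos (b * s + c) * (derive1 (derive1 u) s + b ^+ 2 * u s)) = 0.
Proof.
move=> su; have su1 := schwartz_derive1 su; have su2 := schwartz_derive1 su1.
pose F s := cos (b * s + c) * derive1 u s + b * (sin (b * s + c) * u s).
apply: (@FTC_line _ F).
- move=> s.
  have d1 := schwartz_is_derive s su; have d2 := schwartz_is_derive s su1.
  have da : is_derive s (1 : R) (fun s : R => b * s + c) b.
    by apply: is_derive_eq; rewrite /GRing.scale/= ; ring.
  have dc : is_derive s (1 : R) (fun s : R => cos (b * s + c)) (- b * sin (b * s + c)).
    by apply: is_derive_eq; rewrite /GRing.scale/=; ring.
  have ds : is_derive s (1 : R) (fun s : R => sin (b * s + c)) (b * cos (b * s + c)).
    by apply: is_derive_eq; rewrite /GRing.scale/=; ring.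
  rewrite /F; apply: is_derive_eq; rewrite /GRing.scale/=; ring.
- move=> s; apply: cvgM; first exact: continuous_cos_affine.
  apply: cvgD; first exact: schwartz_continuous su2 s.
  by apply: cvgM; [exact: cvg_cst|exact: schwartz_continuous su s].
- apply: L1_cos_mul; apply: L1D; first exact: schwartz_L1.
  exact/L1Z/schwartz_L1.
- rewrite -[X in _ --> X](addr0 0) -[X in _ --> _ + X](mulr0 b).
  apply: cvgD; last (apply: cvgM; first exact: cvg_cst).
    apply: (schwartz_cvg0 (w := fun x => cos (b * x + c)) su1) => [t|n].
      exact: cos_max.
    by rewrite ger0_norm.
  apply: (schwartz_cvg0 (w := fun x => sin (b * x + c)) su) => [t|n].
    exact: sin_max.
  by rewrite ger0_norm.
- rewrite -[X in _ --> X](addr0 0) -[X in _ --> _ + X](mulr0 b).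
  apply: cvgD; last (apply: cvgM; first exact: cvg_cst).
    apply: (schwartz_cvg0 (w := fun x => cos (b * x + c)) su1) => [t|n].
      exact: cos_max.
    by rewrite normrN ger0_norm.
  apply: (schwartz_cvg0 (w := fun x => sin (b * x + c)) su) => [t|n].
    exact: sin_max.
  by rewrite normrN ger0_norm.
Qed.

(** The transform is bounded by the L1 norm of [u]. Up to sign, (2 pi xi)^2 times it is the
    transform of the second derivative, which bounds the part with xi^2 because (2 pi)^2 is at least
    1. *)
Lemma phase_transform_decay u phi : schwartz_real u ->
  exists C, forall xi, `|phase_transform u phi xi| <= C * (oneDsqr xi)^-1.
Proof.
move=> su; have su1 := schwartz_derive1 su; have su2 := schwartz_derive1 su1.
have Lu := schwartz_L1 su; have Lu2 := schwartz_L1 su2.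
exists (\int[mu]_s `|u s| + \int[mu]_s `|derive1 (derive1 u) s|) => xi.
rewrite ler_pdivlMr ?(lt_le_trans ltr01 (oneDsqr_ge1 _))// /oneDsqr mulrDr mulr1.
apply: lerD.
  apply: norm_Rint_le; [exact: L1_cos_mul|exact: L1_norm|] => s.
  by rewrite normrM ler_piMl// cos_max.
have := phase_transform_ode (2 * pi * xi) phi su.
under eq_Rintegral do rewrite mulrDr [X in _ + X]mulrCA.
rewrite RintegralD//; [|exact: L1_cos_mul|exact/L1Z/L1_cos_mul].
rewrite RintegralZl//; last exact: L1_cos_mul.
rewrite -/(phase_transform u phi xi) => /eqP.
rewrite addr_eq0 => /eqP E.
apply: (@le_trans _ _ `|(2 * pi * xi) ^+ 2 * phase_transform u phi xi|).
  rewrite normrM mulrC ler_wpM2r// exprMn normrM [`|xi ^+ 2|]ger0_norm ?sqr_ge0//.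
  rewrite ler_peMl ?sqr_ge0// ger0_norm ?sqr_ge0//.
  have := pi_ge2 R; nra.
rewrite -normrN -E; apply: norm_Rint_le; [exact: L1_cos_mul|exact: L1_norm|] => s.
by rewrite normrM ler_piMl// cos_max.
Qed.

Lemma continuous_phase_transform u phi : schwartz_real u ->
  continuous (phase_transform u phi).
Proof.
move=> su; have Lu := schwartz_L1 su => xi.
have xin : xi \in `]xi - 1, xi + 1[%classic by rewrite inE/= in_itv/=; lra.
apply: (@continuity_under_integral R _ _ mu
  (fun xi s => cos (2 * pi * xi * s + phi) * u s) setT measurableT
  (xi - 1) (xi + 1) _ _ (fun s => `|u s|) _ _ xi xin).
- by move=> x _; exact: L1_cos_mul.
- apply: aeW => s _ x _; apply: cvgM; last exact: cvg_cst.
  apply: continuous_comp; last exact: continuous_cos.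
  apply: cvgD; last exact: cvg_cst.
  apply: cvgM; last exact: cvg_cst.
  by apply: cvgM; [exact: cvg_cst|exact: cvg_id].
- exact: L1_norm.
- move=> x _; apply: aeW => s _; by rewrite normrM ler_piMl// cos_max.
Qed.

Lemma L1_phase_transform u phi : schwartz_real u -> L1 (phase_transform u phi).
Proof.
move=> su; have [C HC] := phase_transform_decay phi su.
apply: (L1_le _ (L1Z C (@L1_oneDsqrV R)) HC).
apply: continuous_measurable_fun. exact: continuous_phase_transform.
Qed.

End schwartz_functions.

(** * The spectrum of a convolution with a modulated kernel *)

Section band_limited_convolution.
Variable R : realType.
Local Notation mu := (@lebesgue_measure R).

Lemma Rint_le_EFin (f g : R -> R) : measurable_fun [set: R] f -> L1 g ->
  (forall x, `|f x| <= g x) ->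
  (\int[mu]_x (`|f x|)%:E <= (\int[mu]_x g x)%:E)%E.
Proof.
move=> mf Lg fg; rewrite fineK ?(integrable_fin_num measurableT Lg)//.
apply: ge0_le_integral => //.
- exact/measurable_EFinP/measurableT_comp.
- by have /measurable_EFinP := L1_measurable Lg.
- by move=> x _; rewrite lee_fin.
Qed.

Variables (h : R -> R) (B a b : R).
Hypotheses (ch : continuous h) (hB : forall x, `|h x| <= B) (a0 : 0 <= a).

Let kappa (x : R) : R := cos (b * x) * fejer a x.

Let kappaN x : kappa (- x) = kappa x.
Proof. by rewrite /kappa /fejer !mulrN !cosN sqrrN. Qed.

Let Lkappa : L1 kappa. Proof. exact: L1_fejer_cos. Qed.

Let kappa_le x : `|kappa x| <= a ^+ 2 + 2.
Proof.
rewrite normrM (ger0_norm (fejer_ge0 _ _)).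
apply: (@le_trans _ _ (fejer a x)); first by rewrite ler_piMl ?cos_max ?fejer_ge0.
apply: (le_trans (fejer_le a x)); rewrite ler_piMr ?addr_ge0 ?sqr_ge0//.
exact: oneDsqrV_le1.
Qed.

Let mh : measurable_fun [set: R] h.
Proof. exact: continuous_measurable_fun. Qed.

Let B0 : 0 <= B. Proof. exact: le_trans (hB 0). Qed.

(** Written as a correlation; it is the convolution of [h] with the kernel, since the kernel is
    even. *)
Definition fejer_convolution (t : R) : R :=
  \int[mu]_s (h (s + t) * (cos (b * s) * fejer a s)).

Let Lkappa_refl (r : R) : L1 (fun t => kappa (r - t)).
Proof.
have N10 : -1 != 0 :> R by rewrite oppr_eq0 oner_eq0.
have := L1_affine r N10 Lkappa.
by rewrite (_ : (fun x => kappa _) = (fun x => kappa (r - x)))//;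
  apply/funext => x; rewrite mulN1r addrC.
Qed.

Let Lkappa_shift (t : R) : L1 (fun r => kappa (r - t)).
Proof.
have := L1_affine (- t) (oner_neq0 R) Lkappa.
by rewrite (_ : (fun x => kappa _) = (fun x => kappa (x - t)))//;
  apply/funext => x; rewrite mul1r.
Qed.

Lemma fejer_convolutionE t :
  fejer_convolution t = \int[mu]_r (h r * kappa (r - t)).
Proof.
have L : L1 (fun r => h r * kappa (r - t)) by exact: (L1Ml_bounded mh hB).
rewrite -[RHS]mul1r -[X in X * _]invr1 -[X in X^-1 * _](@normr1 R).
rewrite -(Rintegral_affine t (oner_neq0 R) L).
by apply: eq_Rintegral => s _; rewrite mul1r addrK.
Qed.

Lemma norm_fejer_convolution_le t :
  `|fejer_convolution t| <= B * \int[mu]_s fejer a s.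
Proof.
rewrite -RintegralZl//; last exact: L1_fejer.
apply: norm_Rint_le; last first.
- move=> s; rewrite normrM normrM (ger0_norm (fejer_ge0 _ _)).
  apply: ler_pM; rewrite ?hB ?(mulr_ge0 _ (fejer_ge0 _ _))//.
  by rewrite ler_piMl ?fejer_ge0 ?cos_max.
- exact/L1Z/L1_fejer.
- apply: (@L1Ml_bounded _ (fun s => h (s + t)) _ B _ _ Lkappa) => //.
  apply: (measurableT_comp mh).
  by have := measurable_affine 1 t; under eq_fun do rewrite mul1r.
Qed.

Variable I : set R.
(** In contrapositive form: [I] contains the open intervals of half-width [a / (2 * pi)] about
    [b / (2 * pi)] and about its negative, on which the two tents live. *)
Hypothesis I_gap : forall eta, ~ I eta ->
  a <= `|b + 2 * pi * eta| /\ a <= `|b - 2 * pi * eta|.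

Variables (u : R -> R) (phi : R).
Hypotheses (su : schwartz_real u) (uI : forall t, I t -> u t = 0).

Let Lu := schwartz_L1 su.
Let V := phase_transform u phi.
Let LV : L1 V. Proof. exact: L1_phase_transform. Qed.

Let kernel_wave (eta c : R) : ~ I eta ->
  \int[mu]_x (cos (2 * pi * eta * x + c) * kappa x) = 0.
Proof.
move=> /I_gap[g1 g2].
have E x : cos (2 * pi * eta * x + c) * kappa x =
  cos c * (cos (2 * pi * eta * x) * kappa x) - sin c * (sin (2 * pi * eta * x) * kappa x).
  by rewrite cosD; ring.
rewrite (_ : (fun x => _) = (fun x =>
  cos c * (cos (2 * pi * eta * x) * kappa x) -
  sin c * (sin (2 * pi * eta * x) * kappa x))); last exact/funext.
have Lc : L1 (fun x => cos (2 * pi * eta * x) * kappa x).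
  by apply: (L1Ml_bounded (measurable_cosM _) _ Lkappa) => x; exact: cos_max.
have Ls : L1 (fun x => sin (2 * pi * eta * x) * kappa x).
  by apply: (L1Ml_bounded (measurable_sinM _) _ Lkappa) => x; exact: sin_max.
rewrite RintegralB//; [|exact: L1Z|exact: L1Z].
rewrite RintegralZl// RintegralZl//.
by rewrite Rint_fejer_cos_cos// Rint_fejer_sin_cos !mulr0 subrr.
Qed.

(** After an exchange of integrals, the inner integral pairs the kernel with a wave of frequency
    [eta]. It vanishes for [eta] outside [I], and inside [I] the factor [u eta] vanishes. *)
Let kernel_transform (r : R) : \int[mu]_t (kappa (r - t) * V t) = 0.
Proof.
pose F (z : R * R) : R := kappa (r - z.1) * (cos (2 * pi * z.1 * z.2 + phi) * u z.2).
have mF : measurable_fun [set: R * R] F.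
  apply: measurable_funM.
    apply: (measurableT_comp (L1_measurable Lkappa)).
    by apply: measurable_funB => //; exact: measurable_fst.
  apply: measurable_funM.
    apply: (measurableT_comp (continuous_measurable_fun (@continuous_cos R))).
    apply: measurable_funD => //; apply: measurable_funM; last exact: measurable_snd.
    by apply: measurable_funM => //; exact: measurable_fst.
  exact: (measurableT_comp (L1_measurable Lu) measurable_snd).
have Lt t : L1 (fun eta => F (t, eta)).
  exact: (L1Z (kappa (r - t)) (L1_cos_mul (2 * pi * t) phi Lu)).
have [||eta|_ E] := @Rint_swap R F
  (fun t => (\int[mu]_eta `|u eta|) * `|kappa (r - t)|) mF.
- move=> t; rewrite mulrC -RintegralZl//; last exact: L1_norm.
  apply: Rint_le_EFin; first exact: L1_measurable.
    exact/L1Z/L1_norm.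
  by move=> eta; rewrite /F/= normrM ler_wpM2l// normrM ler_piMl// cos_max.
- exact/L1Z/L1_norm.
- rewrite /F/= (_ : (fun x => _) =
    (fun x => u eta * (cos (2 * pi * eta * x + phi) * kappa (r - x)))).
    exact/L1Z/L1_cos_mul.
  apply/funext => x; rewrite (_ : 2 * pi * x * eta = 2 * pi * eta * x); ring.
transitivity (\int[mu]_t \int[mu]_eta F (t, eta)).
  by apply: eq_Rintegral => t _; rewrite /F/= RintegralZl//; exact: L1_cos_mul.
rewrite E (_ : (fun y => _) = fun=> 0 * 0).
  by rewrite RintegralZl ?mul0r//; exact: integrable0.
apply/funext => eta; rewrite mul0r /F/=.
pose G t := cos (2 * pi * eta * t + phi) * kappa (r - t).
have LG : L1 G by exact: L1_cos_mul.
transitivity (u eta * \int[mu]_t G t).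
  rewrite -RintegralZl//; apply: eq_Rintegral => t _; rewrite /G.
  rewrite (_ : 2 * pi * t * eta = 2 * pi * eta * t); ring.
have [/uI->|nI] := pselect (I eta); first by rewrite mul0r.
(* The substitution t = x + r moves [r] into the phase, which is why [kernel_wave] admits an
   arbitrary one. *)
have := Rintegral_affine r (oner_neq0 R) LG.
rewrite normr1 invr1 mul1r => <-.
rewrite (_ : (fun x => _) =
  fun x => cos (2 * pi * eta * x + (2 * pi * eta * r + phi)) * kappa x).
  by rewrite kernel_wave// mulr0.
apply/funext => x; rewrite /G -[kappa x]kappaN.
by congr (cos _ * kappa _); ring.
Qed.

(** Since [V] and the kernel are integrable and [h] is bounded, the integrals may be exchanged: for
    each [r], [V] meets the kernel before [h] does, and [kernel_transform] annihilates it. *)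
Lemma fejer_convolution_band :
  L1 (fun t => fejer_convolution t * V t) /\
  \int[mu]_t (fejer_convolution t * V t) = 0.
Proof.
pose F (z : R * R) : R := V z.1 * (h z.2 * kappa (z.2 - z.1)).
have mF : measurable_fun [set: R * R] F.
  apply: measurable_funM.
    exact: (measurableT_comp (L1_measurable LV) measurable_fst).
  apply: measurable_funM.
    exact: (measurableT_comp mh measurable_snd).
  apply: (measurableT_comp (L1_measurable Lkappa)).
  by apply: measurable_funB; [exact: measurable_snd|exact: measurable_fst].
have Lhk t : L1 (fun r => h r * kappa (r - t)) by exact: (L1Ml_bounded mh hB).
have Lt t : L1 (fun r => F (t, r)) by exact: (L1Z (V t) (Lhk t)).
have conv t : fejer_convolution t * V t = \int[mu]_r F (t, r).
  by rewrite fejer_convolutionE mulrC -(RintegralZl _ _ (Lhk t)).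
have kB t : \int[mu]_r `|kappa (r - t)| = \int[mu]_r `|kappa r|.
  have := Rintegral_affine (- t) (oner_neq0 R) (L1_norm Lkappa).
  rewrite normr1 invr1 mul1r => <-; apply: eq_Rintegral => r _; by rewrite mul1r.
have [||r|LE E] := @Rint_swap R F
  (fun t => B * (\int[mu]_r `|kappa r|) * `|V t|) mF.
- move=> t; rewrite -(kB t) mulrC mulrA -RintegralZl//; last exact: L1_norm.
  apply: Rint_le_EFin.
  - exact: (L1_measurable (Lt t)).
  - exact: (L1Z _ (L1_norm (Lkappa_shift t))).
  move=> r; rewrite /F/= normrM -mulrA ler_wpM2l// normrM.
  by rewrite ler_wpM2r.
- exact/L1Z/L1_norm.
- rewrite /F/= (_ : (fun x => _) = (fun x => h r * (kappa (r - x) * V x))).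
    apply: L1Z; apply: (L1Ml_bounded _ _ LV); last by move=> x; exact: kappa_le.
    exact: L1_measurable.
  by apply/funext => x; ring.
rewrite (_ : (fun t => fejer_convolution t * V t) = (fun t => \int[mu]_r F (t, r))).
  split=> //; rewrite E (_ : (fun y => _) = fun=> 0 * 0).
    by rewrite RintegralZl ?mul0r//; exact: integrable0.
  apply/funext => r; rewrite /F/= mul0r.
  transitivity (h r * \int[mu]_t (kappa (r - t) * V t)).
    rewrite -RintegralZl//; last first.
      apply: (L1Ml_bounded _ _ LV); last by move=> x; exact: kappa_le.
      exact: L1_measurable.
    apply: eq_Rintegral => t _; ring.
  by rewrite kernel_transform mulr0.
exact/funext.
Qed.

End band_limited_convolution.

(** * Band-limitedness in real terms; translations and limits *)

Section band_limited_functions.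
Variable R : realType.
Local Notation mu := (@lebesgue_measure R).
Implicit Types u v : R -> R.

Lemma derive1_lincomb (b : R) u v : schwartz_real u -> schwartz_real v ->
  derive1 (fun t => u t + b * v t) = (fun t => derive1 u t + b * derive1 v t).
Proof.
move=> su sv; apply/funext => t.
have du := schwartz_is_derive t su; have dv := schwartz_is_derive t sv.
have d : is_derive t (1 : R) (fun t => u t + b * v t) (derive1 u t + b * derive1 v t).
  by apply: is_derive_eq; rewrite /GRing.scale/=; ring.
by rewrite derive1E derive_val.
Qed.

Lemma schwartz_lincomb (b : R) u v : schwartz_real u -> schwartz_real v ->
  schwartz_real (fun t => u t + b * v t).
Proof.
suff H n : forall u v, schwartz_real u -> schwartz_real v ->
    (forall t : R, derivable (derive1n n (fun t => u t + b * v t)) t 1) /\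
    (forall k : nat, exists C : R, forall t,
      `|t| ^+ k * `|derive1n n (fun t => u t + b * v t) t| <= C).
  by move=> su sv; split => [n|k n]; have [] := H n u v su sv.
elim: n => [{}u {}v su sv|n IH {}u {}v su sv]; last first.
  by rewrite derive1nSr derive1_lincomb//; apply: IH; exact: schwartz_derive1.
rewrite derive1n0; split=> [t|k].
  have du := schwartz_is_derive t su; have dv := schwartz_is_derive t sv.
  by apply: ex_derive.
have [C HC] := su.2 k 0%N; have [C' HC'] := sv.2 k 0%N.
exists (C + `|b| * C') => t.
apply: (@le_trans _ _ (`|t| ^+ k * (`|u t| + `|b| * `|v t|))).
  by rewrite ler_wpM2l ?exprn_ge0// (le_trans (ler_normD _ _))// normrM.
have := HC t; have := HC' t; rewrite !derive1n0 => hC' hC.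
by rewrite mulrDr lerD// mulrCA ler_wpM2l.
Qed.

Lemma schwartzN u : schwartz_real u -> schwartz_real (fun t => - u t).
Proof.
move=> su; rewrite (_ : (fun t => _) = (fun t => u t + - 2 * u t)).
  exact: schwartz_lincomb.
by apply/funext => t; ring.
Qed.

(** The real part of (u + i v) exp (- i b t). With two amplitudes the family is closed under
    differentiation, which drives the induction in [schwartz_modulate]. *)
Definition modulate (b : R) u v (t : R) := u t * cos (b * t) + v t * sin (b * t).

Lemma modulate_is_derive b u v (t : R) : schwartz_real u -> schwartz_real v ->
  is_derive t (1 : R) (modulate b u v)
    (modulate b (fun t => derive1 u t + b * v t) (fun t => derive1 v t + - b * u t) t).
Proof.
move=> su sv.
have du := schwartz_is_derive t su; have dv := schwartz_is_derive t sv.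
have da : is_derive t (1 : R) (fun s : R => b * s) b.
  by apply: is_derive_eq; rewrite /GRing.scale/= ; ring.
have dc : is_derive t (1 : R) (fun s : R => cos (b * s)) (- b * sin (b * t)).
  by apply: is_derive_eq; rewrite /GRing.scale/=; ring.
have ds : is_derive t (1 : R) (fun s : R => sin (b * s)) (b * cos (b * t)).
  by apply: is_derive_eq; rewrite /GRing.scale/=; ring.
rewrite /modulate; apply: is_derive_eq; rewrite /GRing.scale/=; ring.
Qed.

Lemma schwartz_modulate (b : R) u v : schwartz_real u -> schwartz_real v ->
  schwartz_real (modulate b u v).
Proof.
suff H n : forall u v, schwartz_real u -> schwartz_real v ->
    (forall t : R, derivable (derive1n n (modulate b u v)) t 1) /\
    (forall k : nat, exists C : R, forall t,
      `|t| ^+ k * `|derive1n n (modulate b u v) t| <= C).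
  by move=> su sv; split => [n|k n]; have [] := H n u v su sv.
elim: n => [{}u {}v su sv|n IH {}u {}v su sv]; last first.
  rewrite derive1nSr (_ : derive1 (modulate b u v) = modulate b
    (fun t => derive1 u t + b * v t) (fun t => derive1 v t + - b * u t)).
    by apply: IH; apply: schwartz_lincomb => //; exact: schwartz_derive1.
  apply/funext => t; have d := modulate_is_derive b t su sv.
  by rewrite derive1E derive_val.
rewrite derive1n0; split=> [t|k].
  by have d := modulate_is_derive b t su sv; exact: ex_derive.
have [C HC] := su.2 k 0%N; have [C' HC'] := sv.2 k 0%N.
exists (C + C') => t.
apply: (@le_trans _ _ (`|t| ^+ k * (`|u t| + `|v t|))).
  rewrite ler_wpM2l ?exprn_ge0// (le_trans (ler_normD _ _))// !normrM.
  by rewrite lerD// ler_piMr// ?cos_max ?sin_max.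
by have := HC t; have := HC' t; rewrite !derive1n0 mulrDr => *; exact: lerD.
Qed.

(** The real part of the Fourier transform of u + i v. The imaginary part is the same expression for
    the pair [v], [- u]. *)
Definition mixed_transform u v (xi : R) :=
  \int[mu]_s (cos (2 * pi * xi * s) * u s + sin (2 * pi * xi * s) * v s).

Lemma mixed_transformE u v xi : schwartz_real u -> schwartz_real v ->
  mixed_transform u v xi = phase_transform u 0 xi + phase_transform v (- (pi / 2)) xi.
Proof.
move=> su sv; rewrite /mixed_transform /phase_transform.
under [X in _ = X + _]eq_Rintegral do rewrite addr0.
under [X in _ = _ + X]eq_Rintegral do rewrite cosBpihalf.
have Lu := schwartz_L1 su; have Lv := schwartz_L1 sv.
rewrite RintegralD//.
- by apply: (L1Ml_bounded (measurable_cosM _) _ Lu) => x; exact: cos_max.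
- by apply: (L1Ml_bounded (measurable_sinM _) _ Lv) => x; exact: sin_max.
Qed.

Lemma L1_mixed_transform u v : schwartz_real u -> schwartz_real v ->
  L1 (mixed_transform u v).
Proof.
move=> su sv; rewrite (_ : mixed_transform u v =
  fun xi => phase_transform u 0 xi + phase_transform v (- (pi / 2)) xi).
  by apply: L1D; exact: L1_phase_transform.
by apply/funext => xi; exact: mixed_transformE.
Qed.

(** The two modulated functions are the real and imaginary parts of (u + i v) exp (2 pi i b s), and
    modulation shifts the transform. *)
Lemma mixed_transform_modulate (b : R) u v xi :
  mixed_transform (modulate (2 * pi * b) u (fun t => - v t))
    (modulate (2 * pi * b) v u) xi = mixed_transform u v (xi - b).
Proof.
apply: eq_Rintegral => s _; rewrite /modulate.
have -> : 2 * pi * (xi - b) * s = 2 * pi * xi * s - 2 * pi * b * s by ring.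
by rewrite cosB sinB; ring.
Qed.

Lemma fourierE (g : R -> R[i]) (t : R) :
  fourier g t =
  Complex (mixed_transform (fun s => complex.Re (g s)) (fun s => complex.Im (g s)) t)
   (mixed_transform (fun s => complex.Im (g s)) (fun s => - complex.Re (g s)) t).
Proof.
rewrite /fourier /cintegral; congr Complex; apply: eq_Rintegral => s _.
  rewrite (_ : 2 * pi * s * t = 2 * pi * t * s); last by ring.
  by case: (g s) => x y /=; ring.
rewrite (_ : 2 * pi * s * t = 2 * pi * t * s); last by ring.
by case: (g s) => x y /=; ring.
Qed.

(** One real equation suffices: applied to - i g, which has the same support as g, it also gives the
    imaginary part. *)
Lemma band_limitedP (I : set R) (f : R -> R) :
  band_limited I (fun t => (f t)%:C%C) <->
  (forall u v, schwartz_real u -> schwartz_real v ->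
    closure [set t | u t != 0 \/ v t != 0] `&` I = set0 ->
    \int[mu]_t (f t * mixed_transform u v t) = 0).
Proof.
have FE g : fourier_distribution (fun t => (f t)%:C%C) g = Complex
  (\int[mu]_t (f t *
     mixed_transform (fun s => complex.Re (g s)) (fun s => complex.Im (g s)) t))
  (\int[mu]_t (f t *
     mixed_transform (fun s => complex.Im (g s)) (fun s => - complex.Re (g s)) t)).
  rewrite /fourier_distribution /cintegral; congr Complex; apply: eq_Rintegral => t _;
    rewrite fourierE/= mul0r; ring.
have supp u v : [set t | u t != 0 \/ v t != 0] =
    [set t | Complex (u t) (v t) != 0].
  apply/seteqP; split=> t /=; rewrite eq_complex/= negb_and => /orP//.
split=> [bf u v su sv uvI|bf g [su sv] gI].
  have := bf (fun t => Complex (u t) (v t)) (conj su sv).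
  rewrite FE -supp => /(_ uvI).
  by move/eqP; rewrite eq_complex/= => /andP[/eqP].
have gE : [set t | g t != 0] =
    [set t | complex.Re (g t) != 0 \/ complex.Im (g t) != 0].
  by rewrite supp; apply/seteqP; split => t /=; case: (g t).
rewrite FE; apply/eqP; rewrite eq_complex/= bf ?eqxx//=; last by rewrite -gE.
rewrite bf//; first exact: schwartzN.
rewrite -gI gE; congr (closure _ `&` _).
apply/seteqP; split => t /=; rewrite oppr_eq0; tauto.
Qed.

(** Translating [f] amounts to translating the transform of the test function, that is, to
    modulating the test function. This preserves its modulus, hence its support; the modulus enters
    as u^2 + v^2. *)
Lemma band_limited_translate (I : set R) (f : R -> R) (tau B : R) :
  continuous f -> (forall t, `|f t| <= B) ->
  band_limited I (fun t => (f t)%:C%C) ->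
  band_limited I (fun t => (translate tau f t)%:C%C).
Proof.
move=> cf fB /band_limitedP bf; apply/band_limitedP => u v su sv uvI.
have svN := schwartzN sv.
set u' := modulate (2 * pi * tau) u (fun t => - v t).
set v' := modulate (2 * pi * tau) v u.
have su' : schwartz_real u' by exact: schwartz_modulate.
have sv' : schwartz_real v' by exact: schwartz_modulate.
have LM := L1_mixed_transform su sv.
have Lshift : L1 (fun t => mixed_transform u v (t - tau)).
  have := L1_affine (- tau) (oner_neq0 R) LM.
  by rewrite (_ : (fun x => mixed_transform u v _) =
    (fun t => mixed_transform u v (t - tau)))//; apply/funext => x; rewrite mul1r.
rewrite -(bf u' v')//; last first.
  have nz (x y : R) : (x != 0 \/ y != 0) <-> x ^+ 2 + y ^+ 2 != 0.
    rewrite paddr_eq0 ?sqr_ge0// !sqrf_eq0 negb_and.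
    by split=> [[]->|/orP]//; rewrite orbT.
  rewrite -uvI; congr (closure _ `&` _).
  have uvE t : u' t ^+ 2 + v' t ^+ 2 = u t ^+ 2 + v t ^+ 2.
    rewrite -[RHS]mul1r -(cos2Dsin2 (2 * pi * tau * t)) /u' /v' /modulate; ring.
  by apply/seteqP; split => t /=; rewrite !nz uvE.
have LG : L1 (fun t => f t * mixed_transform u v (t - tau)).
  by apply: (L1Ml_bounded _ fB Lshift); exact: continuous_measurable_fun.
transitivity (\int[mu]_t (f t * mixed_transform u v (t - tau))); last first.
  by apply: eq_Rintegral => t _; rewrite mixed_transform_modulate.
have := Rintegral_affine tau (oner_neq0 R) LG.
rewrite normr1 invr1 mul1r => <-; apply: eq_Rintegral => t _.
by rewrite mul1r addrK.
Qed.



Lemma band_limited_lim (I : set R) (f_ : nat -> R -> R) (f : R -> R) (B : R) :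
  (forall n, continuous (f_ n)) -> (forall n t, `|f_ n t| <= B) ->
  (forall t, f_ n t @[n --> \oo] --> f t) ->
  (forall n, band_limited I (fun t => (f_ n t)%:C%C)) ->
  band_limited I (fun t => (f t)%:C%C).
Proof.
move=> cf fB f_f bf; apply/band_limitedP => u v su sv uvI.
have LM := L1_mixed_transform su sv.
have B0 : 0 <= B by exact: le_trans (fB 0%N 0).
have : \int[mu]_t (f_ n t * mixed_transform u v t) @[n --> \oo] -->
       \int[mu]_t (f t * mixed_transform u v t).
  apply: (@Rint_dominated_cvg _ _ _ (fun t => B * `|mixed_transform u v t|)).
  - move=> n; apply: measurable_funM; last exact: L1_measurable.
    exact: continuous_measurable_fun.
  - by move=> t; apply: cvgM; [exact: f_f|exact: cvg_cst].
  - exact/L1Z/L1_norm.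
  - by move=> n t; rewrite normrM ler_wpM2r.
rewrite (_ : (fun n => _) = fun=> 0); last first.
  by apply/funext => n; move/band_limitedP : (bf n) => /(_ u v su sv uvI).
by move=> /(cvg_lim (@Rhausdorff R)) <-; rewrite lim_cst.
Qed.

Lemma band_limited_fejer_convolution (I : set R) (h : R -> R) (B a b c : R) :
  continuous h -> (forall x, `|h x| <= B) -> 0 <= a ->
  (forall eta, ~ I eta -> a <= `|b + 2 * pi * eta| /\ a <= `|b - 2 * pi * eta|) ->
  band_limited I (fun t => (c * fejer_convolution h a b t)%:C%C).
Proof.
move=> ch hB a0 gap; apply/band_limitedP => u v su sv uvI.
have uI t : I t -> u t = 0 /\ v t = 0.
  move=> It; apply: contrapT => /not_andP nuv.
  have : (closure [set t | u t != 0 \/ v t != 0] `&` I) t.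
    split => //; apply: subset_closure => /=.
    by case: nuv => /eqP; [left|right].
  by rewrite uvI.
have [L1u E1] := fejer_convolution_band ch hB a0 gap 0 su (fun t It => (uI t It).1).
have [L1v E2] := fejer_convolution_band ch hB a0 gap (- (pi / 2)) sv (fun t It => (uI t It).2).
rewrite (_ : (fun t => _) = (fun t => c * (fejer_convolution h a b t * phase_transform u 0 t
   + fejer_convolution h a b t * phase_transform v (- (pi / 2)) t))); last first.
  by apply/funext => t; rewrite mixed_transformE//; ring.
rewrite RintegralZl//; last exact: L1D.
by rewrite RintegralD// E1 E2 addr0 mulr0.
Qed.

End band_limited_functions.

(** * Topology *)

Section compact_metrizable.
Variables (R : realType) (X : topologicalType) (e : nat -> X -> R).
Hypotheses (ce : forall k, continuous (e k)) (e1 : forall k x, `|e k x| <= 1).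
Hypothesis e_sep : forall x y, (forall k, e k x = e k y) -> x = y.

(** A supremum with weights tending to 0 takes the place of the usual sum: the triangle inequality
    holds term by term, and no series has to converge. *)
Let term x y (k : nat) : R := k.+1%:R^-1 * `|e k x - e k y|.
Let dist x y := sup (range (term x y)).

Let pow_ge0 k : 0 <= k.+1%:R^-1 :> R.
Proof. by rewrite invr_ge0. Qed.

Let pow_gt0 k : 0 < k.+1%:R^-1 :> R.
Proof. by rewrite invr_gt0. Qed.

Let diff_le2 x y k : `|e k x - e k y| <= 2.
Proof. by rewrite (le_trans (ler_normB _ _))// -[leRHS]/(1 + 1) lerD. Qed.

Let term_le x y k : term x y k <= k.+1%:R^-1 * 2.
Proof. by rewrite ler_wpM2l. Qed.

Let dist_ub x y : has_ubound (range (term x y)).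
Proof.
exists 2 => _ [k _ <-]; apply: (le_trans (term_le x y k)).
by rewrite ler_piMl// invf_le1// ler1n.
Qed.

Let term_le_dist x y k : term x y k <= dist x y.
Proof. by apply: ub_le_sup; [exact: dist_ub|exists k]. Qed.

Let dist_le x y c : (forall k, term x y k <= c) -> dist x y <= c.
Proof.
by move=> H; apply: ge_sup => [|_ [k _ <-]//]; exists (term x y 0%N), 0%N.
Qed.

Let dist_ge0 x y : 0 <= dist x y.
Proof. by apply: (le_trans _ (term_le_dist x y 0)); rewrite mulr_ge0. Qed.

Let dist_near x (eps : R) : 0 < eps -> nbhs x [set y | dist x y < eps].
Proof.
move=> eps0.
have eps20 : 0 < eps / 2 by rewrite divr_gt0.
(* Differences are at most 2, so from index [N] on the weights alone keep the terms below eps / 2;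
   the finitely many earlier terms are handled by continuity. *)
pose N := Num.truncn (4 / eps).
have HN : N.+1%:R^-1 * 2 <= eps / 2.
  have : 4 / eps < N.+1%:R by exact: truncnS_gt.
  rewrite ltr_pdivrMr// => h; rewrite mulrC ler_pdivrMr//; nra.
have near_N n : \forall y \near x, forall k, (k < n)%N -> `|e k x - e k y| < eps / 2.
  elim: n => [|n IH]; first exact: nearW.
  have ne : \forall y \near x, `|e n x - e n y| < eps / 2.
    by have /cvgrPdist_lt/(_ _ eps20) := @ce n x.
  apply: filterS2 IH ne => y hn hy k; rewrite ltnS leq_eqVlt => /orP[/eqP->//|].
  exact: hn.
apply: filterS (near_N N) => y hy /=.
apply: (@le_lt_trans _ _ (eps / 2)); last lra.
apply: dist_le => k; have [/hy hk|Nk] := ltnP k N.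
  rewrite (le_trans _ (ltW hk))// ler_piMl// invf_le1// ler1n//.
apply: (le_trans (term_le x y k)); apply: le_trans HN.
by rewrite ler_wpM2r// lef_pV2 ?posrE// ler_nat ltnS.
Qed.

Lemma compact_separating_metrizable : compact [set: X] -> metrizable R X.
Proof.
move=> cX; exists dist; split.
- move=> x; apply/eqP; rewrite eq_le dist_ge0 andbT; apply: dist_le => k.
  by rewrite /term subrr normr0 mulr0.
- move=> x y dxy; apply: e_sep => k; apply/eqP; rewrite -subr_eq0 -normr_eq0.
  have := term_le_dist x y k; rewrite dxy /term pmulr_rle0// => h.
  by rewrite eq_le h normr_ge0.
- move=> x y; rewrite /dist (_ : term x y = term y x)//.
  by apply/funext => k; rewrite /term distrC.
- move=> x y z; apply: dist_le => k.
  apply: (@le_trans _ _ (term x y k + term y z k)); last exact: lerD.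
  by rewrite -mulrDr ler_wpM2l// ler_distD.
move=> x; apply/seteqP; split => [U xU|U [eps /= eps0 /filterS]]; last first.
  by apply; exact: dist_near.
(* If no ball about [x] fits into [U], the balls with [U] removed generate a proper filter. It
   clusters at some [p] by compactness; all [e k] agree at [x] and [p], so [p] is [x], yet the
   filter avoids the neighbourhood [U]. *)
apply: contrapT => noeps.
pose F := filter_from [set eps : R | 0 < eps] (fun eps => [set y | dist x y < eps /\ ~ U y]).
have FF : ProperFilter F.
  apply: filter_from_proper; last first.
    move=> eps /= eps0; apply: contrapT => H; apply: noeps; exists eps => //.
    by move=> y /= dy; apply: contrapT => Uy; apply: H; exists y.
  apply: filter_from_filter; first by exists 1 => /=.
  move=> i j /= i0 j0; exists (Num.min i j); first by rewrite /= lt_min i0.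
  by move=> y [] /=; rewrite lt_min => /andP[? ?] ?; split.
have [p [_ Fp]] := cX F FF filterT.
have px : x = p.
  apply: e_sep => k; apply/eqP; rewrite -subr_eq0 -normr_le0.
  apply/ler_addgt0Pr => eps eps0; rewrite add0r.
  have eps20 : 0 < eps / 2 by rewrite divr_gt0.
  have F1 : F [set y | dist x y < k.+1%:R^-1 * (eps / 2) /\ ~ U y].
    by exists (k.+1%:R^-1 * (eps / 2)) => //=; exact: mulr_gt0.
  have N1 : nbhs p [set y | `|e k p - e k y| < eps / 2].
    by have /cvgrPdist_lt/(_ _ eps20) := @ce k p.
  have [y [[dy _] /= ey]] := Fp _ _ F1 N1.
  have := le_lt_trans (term_le_dist x y k) dy.
  rewrite /term ltr_pM2l// => ey'.
  rewrite (le_trans (ler_distD (e k y) _ _))// [leRHS]splitr lerD ?(ltW ey')//.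
  by rewrite distrC ltW.
have F1 : F [set y | dist x y < 1 /\ ~ U y] by exists 1 => /=.
rewrite px in xU.
by have [y [[_ nUy] Uy]] := Fp _ _ F1 xU.
Qed.

End compact_metrizable.

Section topology_lemmas.

Lemma metrizable_hausdorff (R : realType) (X : topologicalType) :
  metrizable R X -> hausdorff_space X.
Proof.
move=> [d [d0 dsep dsym dtri dn]] p q pq; apply: dsep.
have dge0 x y : 0 <= d x y by have := dtri x y x; rewrite d0 (dsym y x); lra.
apply/eqP; rewrite eq_le dge0 andbT; apply/ler_addgt0Pr => eps eps0; rewrite add0r.
have eps20 : 0 < eps / 2 by rewrite divr_gt0.
have nb x : nbhs x [set y | d x y < eps / 2] by rewrite dn; exists (eps / 2).
have [y [/= py qy]] := pq _ _ (nb p) (nb q).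
by have := dtri p y q; rewrite (dsym y q); move: py qy => /=; lra.
Qed.

(** Closed sets of [Y] are compact, so their images are compact and hence closed in [X]; this is the
    continuity of the inverse. *)
Lemma compact_injective_homeomorphism (Y X : topologicalType) (phi : Y -> X) :
  compact [set: Y] -> hausdorff_space X -> continuous phi -> injective phi ->
  homeomorphism_onto_image phi.
Proof.
move=> cY hX cphi iphi; split => //.
pose psi (z : set_type (range phi)) := sval (cid2 (set_valP z)).
have phiK z : phi (psi z) = \val z by rewrite /psi; case: cid2.
exists psi => //; apply/continuous_closedP => C clC.
have -> : psi @^-1` C = (\val : set_type (range phi) -> X) @^-1` (phi @` C).
  apply/seteqP; split => z /=; first by move=> Cz; exists (psi z).
  by move=> [y Cy]; rewrite -phiK => /iphi <-.
apply: closed_comp.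
  by move=> z _; exact: (@initial_continuous _ _ (\val : set_type (range phi) -> X)).
apply: compact_closed => //; apply: continuous_compact.
  exact: continuous_subspaceT.
by apply: (subclosed_compact clC cY).
Qed.

Lemma compact_set_type (X : topologicalType) (A : set X) :
  compact A -> compact [set: set_type A].
Proof.
move=> cA F FF _.
have PF : ProperFilter ((\val : set_type A -> X) @ F) by exact: fmap_proper_filter.
have FA : ((\val : set_type A -> X) @ F) A.
  by apply: (@filterS _ F _ setT) => [[z /= /set_mem]|]//; exact: filterT.
have [p [Ap Fp]] := cA _ PF FA.
exists (exist _ p (mem_set Ap)); split => // B U FB [? /= [[W oW <-]] /= Wp WU].
have FB' : ((\val : set_type A -> X) @ F) ((\val : set_type A -> X) @` B).
  by apply: (@filterS _ F _ B) => // z Bz; exists z.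
have [_ [[b Bb <-] Wb]] := Fp _ _ FB' (open_nbhs_nbhs (conj oW Wp)).
by exists b; split => //; exact: WU.
Qed.

Lemma compact_prod_topology (I : eqType) (T : I -> topologicalType) :
  (forall i, compact [set: T i]) -> compact [set: prod_topology T].
Proof.
move=> cT; have := tychonoff cT; congr compact.
by apply/seteqP; split.
Qed.

Lemma continuous_into_prod (Z : topologicalType) (I : eqType)
    (T : I -> topologicalType) (f : Z -> prod_topology T) :
  (forall i, continuous (fun z => f z i)) -> continuous f.
Proof.
move=> cf z; apply/cvg_sup => i.
exact: (@continuous_comp_initial _ _ _ (@proj I T i) f (cf i)).
Qed.

Lemma continuous_prod_eval (I : eqType) (T : I -> topologicalType) (i : I) :
  continuous (fun x : prod_topology T => x i).
Proof. exact: proj_continuous. Qed.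

End topology_lemmas.

(** * Lipschitz functions: pointwise and locally uniform convergence *)

Section lipschitz_subspace.
Variables (R : realType) (A : set {family compact, R -> R}).
Hypothesis AL : A `<=` @lipschitz_ball R.

Lemma continuous_lipschitz_eval (s : R) :
  continuous (fun f : set_type A => (\val f : R -> R) s).
Proof.
move=> f.
have c1 : {for f, continuous (\val : set_type A -> {family compact, R -> R})}.
  exact: (@initial_continuous _ _ (\val : set_type A -> {family compact, R -> R})).
have c2 : {ptws, nbhs (\val f : {family compact, R -> R}) --> (\val f : R -> R)}.
  exact: pointwise_cvg_compact_family.
have /pointwise_cvgP/(_ s) c3 := c2.
exact: (cvg_comp _ _ c1 c3).
Qed.

Lemma equicontinuous_lipschitz_ball :
  equicontinuous (@lipschitz_ball R : set (R -> R)) id.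
Proof.
move=> x E; rewrite -entourage_ballE => -[e /= e0 eE].
near=> y => f [_ Lf]; apply: eE => /=; rewrite /ball/=.
apply: (le_lt_trans (Lf _ _)).
by near: y; apply: nbhsx_ballx.
Unshelve. all: by end_near. Qed.

(** On an equicontinuous family, pointwise convergence is already uniform on compact sets. Every
    later continuity check thereby reduces to single evaluations. *)
Lemma continuous_into_lipschitz (Z : topologicalType) (G : Z -> set_type A) :
  (forall s, continuous (fun z => (\val (G z) : R -> R) s)) -> continuous G.
Proof.
move=> cG; apply: (@continuous_comp_initial _ _ _
  (\val : set_type A -> {family compact, R -> R}) G) => z.
have PF : ProperFilter ((\val \o G : Z -> {ptws R -> R}) @ z).
  exact: fmap_proper_filter.
apply: (pointwise_compact_cvg (\val (G z)) PF _).1.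
  apply/near_powerset_filter_fromP.
    exact: equicontinuous_subset_id.
  exists (@lipschitz_ball R); last exact: equicontinuous_lipschitz_ball.
  by apply: nearW => w; apply: AL; exact: set_mem (valP (G w)).
by apply/pointwise_cvgP => s; exact: cG.
Qed.

(** Ascoli gives precompactness. Closedness is asked only along pointwise convergent sequences, the
    form dominated convergence can deliver: a function in the closure is the limit of elements of
    [A] that are 1 / (n + 1)-close to it on [-n, n]. *)
Lemma compact_lipschitz_subspace :
  (forall (f_ : nat -> R -> R) (f : R -> R), (forall n, A (f_ n)) ->
    (forall t, f_ n t @[n --> \oo] --> f t) -> A f) ->
  compact A.
Proof.
move=> Aseq.
have pA : precompact (A : set {family compact, R -> R}).
  apply: pointwise_precompact_equicontinuous.
  - exact: Rhausdorff.
  - move=> x; apply: (@precompact_subset R _ (`[-1, 1]%classic : set R)).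
      by move=> _ [f Af <-] /=; rewrite in_itv/=; have [] := AL Af.
    by rewrite precompact_closed; [exact: segment_compact|exact: itv_closed].
  - apply: (equicontinuous_subset_id AL); exact: equicontinuous_lipschitz_ball.
suff clA : closed A by rewrite -precompact_closed.
move=> f clf.
have ex n : exists g, A g /\ forall t, `|t| <= n%:R -> `|f t - g t| < n.+1%:R^-1.
  have n0 : 0 < n.+1%:R^-1 :> R by rewrite invr_gt0.
  have cK : compact (`[- n%:R, n%:R]%classic : set R) by exact: segment_compact.
  have := @fam_nbhs R R compact _ _ f (@entourage_ball R R (PosNum n0)) cK.
  move=> /clf [g [Ag /= Hg]]; exists g; split => // t tn.
  by apply: Hg; rewrite /= in_itv/= -ler_norml.
have [g Hg] := choice ex.
apply: (Aseq g) => [n|t]; first by have [] := Hg n.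
apply/cvgrPdist_lt => e e0; near=> n.
have [_ /(_ t) h] := Hg n.
apply: lt_trans (h _) _; first by near: n; exact: nbhs_infty_ger.
by near: n; exact: near_infty_natSinv_lt (PosNum e0).
Unshelve. all: by end_near. Qed.

End lipschitz_subspace.

(** * Test functions on a flow *)

Section metrizable_facts.
Variables (R : realType) (Y : topologicalType).
Hypothesis mY : metrizable R Y.

(** Dominated convergence treats sequences only; this turns it into continuity in the point of the
    phase space. *)
Lemma metrizable_seq_continuous (G : Y -> R) :
  (forall y0 (y_ : nat -> Y), y_ n @[n --> \oo] --> y0 ->
     G (y_ n) @[n --> \oo] --> G y0) ->
  continuous G.
Proof.
move=> Gseq y0; apply/cvgrPdist_lt => eps eps0; apply: contrapT => noG.
have [d [d0 dsep dsym dtri dn]] := mY.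
have ex n : exists y, d y0 y < n.+1%:R^-1 /\ ~ `|G y0 - G y| < eps.
  apply: contrapT => H; apply: noG.
  suff: nbhs y0 [set t | `|G y0 - G t| < eps] by []; rewrite dn.
  exists n.+1%:R^-1; first by rewrite /= invr_gt0.
  by move=> y /= dy; apply: contrapT => Gy; apply: H; exists y.
have [y_ Hy] := choice ex.
have y_cvg : y_ n @[n --> \oo] --> y0.
  move=> U; rewrite dn => -[e /= e0 eU].
  suff : \forall n \near \oo, U (y_ n) by [].
  near=> n; apply: eU => /=.
  apply: (lt_trans (Hy n).1).
  by near: n; exact: near_infty_natSinv_lt (PosNum e0).
have /cvgrPdist_lt/(_ _ eps0)[N _ HN] := Gseq _ _ y_cvg.
by have [_] := Hy N; apply; apply: HN => /=.
Unshelve. all: by end_near. Qed.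

(** The functions are truncated distances to the points of finite 1 / (n + 1)-nets. Were there no
    such net, the sets of points far from a given finite set would generate a proper filter, and it
    could not cluster anywhere. *)
Lemma compact_metrizable_separating : compact [set: Y] ->
  exists f : nat -> Y -> R, [/\ forall n, continuous (f n),
    forall n y, 0 <= f n y <= 1 &
    forall x y, (forall n, f n x = f n y) -> x = y].
Proof.
move=> cY; have [d [d0 dsep dsym dtri dn]] := mY.
have dge0 x y : 0 <= d x y by have := dtri x y x; rewrite d0 (dsym y x); lra.
have net n : exists s : seq Y, forall y, exists2 q, q \in s & d q y < n.+1%:R^-1.
  apply: contrapT => nonet.
  pose F := filter_from [set: seq Y]
    (fun s => [set y | forall q, q \in s -> n.+1%:R^-1 <= d q y]).
  have FF : ProperFilter F.
    apply: filter_from_proper; last first.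
      move=> s _; apply: contrapT => Fs; apply: nonet; exists s => y.
      apply: contrapT => ny; apply: Fs; exists y => q qs /=.
      by rewrite leNgt; apply/negP => dq; apply: ny; exists q.
    apply: filter_from_filter; first by exists [::].
    move=> s t _ _; exists (s ++ t) => // y /= yst.
    by split => q qs; apply: yst; rewrite mem_cat qs ?orbT.
  have [p [_ Fp]] := cY F FF filterT.
  have F1 : F [set y | forall q, q \in [:: p] -> n.+1%:R^-1 <= d q y] by exists [:: p].
  have N1 : nbhs p [set y | d p y < n.+1%:R^-1].
    by rewrite dn; exists n.+1%:R^-1 => //=; rewrite invr_gt0.
  have [y [/= /(_ p (mem_head _ _)) py]] := Fp _ _ F1 N1.
  by rewrite ltNge py.
have [s_ Hs] := choice net.
pose f (p : nat * nat) y := if onth (s_ p.1) p.2 is Some q then Num.min 1 (d q y) else 0.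
have cf p : continuous (f p).
  move=> y0; apply/cvgrPdist_lt => eps eps0.
  suff: nbhs y0 [set t | `|f p y0 - f p t| < eps] by []; rewrite dn.
  exists eps => // y /= dy; rewrite /f; case: onth => [q|]; last first.
    by rewrite subrr normr0.
  have := dtri q y y0; have := dtri q y0 y; rewrite (dsym y y0) => h1 h2.
  rewrite ltr_norml; case: (leP 1 (d q y0)) => ?; case: (leP 1 (d q y)) => ?; lra.
have f01 p y : 0 <= f p y <= 1.
  rewrite /f; case: onth => [q|]; last by rewrite lexx ler01.
  by have := dge0 q y; case: (leP 1 (d q y)) => ? ?; lra.
exists (fun n => f (odflt (0%N, 0%N) (unpickle n))); split => // x y fxy.
have {}fxy p : f p x = f p y.
  by have := fxy (pickle p); rewrite pickleK.
apply: dsep; apply/eqP; rewrite eq_le dge0 andbT leNgt; apply/negP => dxy.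
(* Below 1 the truncation is inactive at [x], so equal values force d q y = d q x; below d x y / 2
   this contradicts the triangle inequality. *)
pose r := Num.min (1 : R) (d x y / 2).
have r0 : 0 < r by rewrite lt_min ltr01 divr_gt0.
have [N HN] : exists N : nat, N.+1%:R^-1 < r.
  by have [N _ HN] := near_infty_natSinv_lt (PosNum r0); exists N; apply: HN => /=.
have [q qs dq] := Hs N x.
have := fxy (N, index q (s_ N)); rewrite /f /=.
have -> : onth (s_ N) (index q (s_ N)) = Some q.
  by rewrite onthE (nth_map q) ?index_mem ?nth_index.
move: (lt_trans dq HN); rewrite lt_min => /andP[dq1 dq2].
have := dtri x q y; rewrite (dsym x q).
by case: (leP 1 (d q x)) => ?; case: (leP 1 (d q y)) => ?; lra.
Qed.

End metrizable_facts.

(** * Lipschitz regularization along orbits *)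

Section orbit_regularization.
Variables (R : realType) (Y : topologicalType) (S : R -> Y -> Y).
Hypotheses (cS : continuous (fun p : R * Y => S p.1 p.2))
  (S0 : forall y, S 0 y = y) (SD : forall r s y, S (r + s) y = S r (S s y)).
Variable f : Y -> R.
Hypotheses (cf : continuous f) (f01 : forall y, 0 <= f y <= 1).

Let cost (k : nat) y (s : R) := f (S s y) + k.+1%:R * `|s|.

(* Inf-convolution along the orbit: Lipschitz along orbits, and increasing to
   f as k grows. *)
Definition orbit_inf (k : nat) (y : Y) : R := inf (range (cost k y)).

Let cost_ge0 k y s : 0 <= cost k y s.
Proof. by have /andP[f0 _] := f01 (S s y); rewrite addr_ge0// mulr_ge0. Qed.

Lemma orbit_inf_le k y s : orbit_inf k y <= f (S s y) + k.+1%:R * `|s|.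
Proof. by apply: ge_inf; [exists 0 => _ [? _ <-]; exact: cost_ge0|exists s]. Qed.

Lemma orbit_inf_ge k y c :
  (forall s, c <= f (S s y) + k.+1%:R * `|s|) -> c <= orbit_inf k y.
Proof.
by move=> H; apply: lb_le_inf => [|_ [s _ <-]]; [exists (cost k y 0), 0|exact: H].
Qed.

Lemma orbit_inf_le_fun k y : orbit_inf k y <= f y.
Proof. by have := orbit_inf_le k y 0; rewrite S0 normr0 mulr0 addr0. Qed.

Lemma orbit_inf_itv k y : 0 <= orbit_inf k y <= 1.
Proof.
have /andP[_ f1] := f01 y; rewrite (le_trans (orbit_inf_le_fun k y))// andbT.
by apply: orbit_inf_ge => s; exact: cost_ge0.
Qed.

Lemma orbit_inf_lipschitz k y s t :
  `|orbit_inf k (S s y) - orbit_inf k (S t y)| <= k.+1%:R * `|s - t|.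
Proof.
suff H s' t' : orbit_inf k (S s' y) - k.+1%:R * `|s' - t'| <= orbit_inf k (S t' y).
  by rewrite ler_norml; have := H s t; have := H t s; rewrite (distrC t s); lra.
apply: orbit_inf_ge => r.
(* From [S s' y] this time leads to the point reached from [S t' y] in time [r]; the penalties
   differ by at most k + 1 times |s' - t'|. *)
have := orbit_inf_le k (S s' y) (r + (t' - s')).
rewrite -!SD -addrA subrK => h.
have : `|r + (t' - s')| <= `|r| + `|s' - t'|.
  by rewrite (distrC s'); exact: ler_normD.
rewrite -(ler_pM2l (ltr0Sn R k)) => h'; lra.
Qed.

Let joint : continuous (fun p : R * Y => f (S p.1 p.2)).
Proof. by move=> p; apply: continuous_comp; [exact: cS|exact: cf]. Qed.

(** Beyond |s| = 2 the penalty exceeds 1, a bound for the infimum, so only times in [-2, 2] matter.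
    On this compact interval joint continuity makes the values at nearby points uniformly close. *)
Lemma orbit_inf_continuous k : continuous (orbit_inf k).
Proof.
move=> y0; apply/cvgrPdist_le => eps eps0.
have eps20 : 0 < eps / 2 by rewrite divr_gt0.
have unif : \forall y \near y0, `[-2, 2]%classic `<=`
    [set s : R | `|f (S s y0) - f (S s y)| < eps].
  have /compact_near_coveringP cK : compact (`[-2, 2]%classic : set R).
    exact: segment_compact.
  apply: (cK Y (nbhs y0) (fun y s => `|f (S s y0) - f (S s y)| < eps)) => s _.
  have /cvgrPdist_lt/(_ _ eps20) := @joint (s, y0).
  move=> [[U V] /= [sU yV] UV]; exists (U, V) => //= -[s' y] /= [Us' Vy].
  have h1 := UV (s', y) (conj Us' Vy).
  have h2 := UV (s', y0) (conj Us' (nbhs_singleton yV)).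
  move: h1 h2 => /=; rewrite !ltr_norml; lra.
apply: filterS unif => y hy.
suff H x x' : (forall s : R, `|s| <= 2 -> `|f (S s x) - f (S s x')| < eps) ->
    orbit_inf k x - eps <= orbit_inf k x'.
  have hy' s : `|s| <= 2 -> `|f (S s y0) - f (S s y)| < eps.
    by move=> s2; apply: hy; rewrite /= in_itv/= -ler_norml.
  have h1 := H _ _ hy'.
  have h2 : orbit_inf k y - eps <= orbit_inf k y0.
    by apply: H => s s2; rewrite distrC; exact: hy'.
  rewrite ler_norml; lra.
move=> hx; apply: orbit_inf_ge => s.
have [s2|s2] := leP `|s| 2.
  have := orbit_inf_le k x s; have := hx s s2; rewrite ltr_norml; lra.
have /andP[_ o1] := orbit_inf_itv k x; have /andP[f0 _] := f01 (S s x').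
have : `|s| <= k.+1%:R * `|s| by rewrite ler_peMl// ler1n.
lra.
Qed.

Lemma orbit_inf_separates y1 y2 :
  (forall k, orbit_inf k y1 = orbit_inf k y2) -> f y1 = f y2.
Proof.
suff H z1 z2 : (forall k, orbit_inf k z1 = orbit_inf k z2) -> f z1 <= f z2.
  by move=> E; apply/eqP; rewrite eq_le !H.
move=> E; apply/ler_addgt0Pr => eps eps0.
have /cvgrPdist_lt/(_ _ eps0)[[U V] /= [sU yV] UV] := @joint (0, z1).
move: sU => /nbhs_ballP[del /= del0 delU].
(* For this [k] the penalty is at least 1, hence at least [f z1], once |s| reaches [del]; for
   shorter times [f (S s z1)] is within [eps] of [f z1]. *)
have [k Hk] : exists k : nat, k.+1%:R^-1 < del.
  by have [N _ HN] := near_infty_natSinv_lt (PosNum del0); exists N; apply: HN => /=.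
rewrite -lerBlDr; apply: le_trans (orbit_inf_le_fun k z2); rewrite -E.
apply: orbit_inf_ge => s.
have [sd|sd] := ltP `|s| del.
  have Us : U s by apply: delU; rewrite /ball/= sub0r normrN.
  have := UV (s, z1) (conj Us (nbhs_singleton yV)).
  rewrite /= S0 ltr_norml; have : 0 <= k.+1%:R * `|s| by rewrite mulr_ge0.
  lra.
have /andP[_ f1] := f01 z1; have /andP[f0 _] := f01 (S s z1).
have : 1 <= k.+1%:R * `|s|.
  rewrite -ler_pdivrMl// mulr1; exact: ltW (lt_le_trans Hk sd).
lra.
Qed.

End orbit_regularization.

Lemma flow_test_functions (R : realType) (Y : topologicalType) (S : R -> Y -> Y) :
  real_flow S ->
  exists (g : nat -> Y -> R) (K : nat -> R), [/\ forall n, continuous (g n),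
    forall n y, 0 <= g n y <= 1,
    forall n, 0 <= K n,
    forall n y s t, `|g n (S s y) - g n (S t y)| <= K n * `|s - t| &
    forall x y, (forall n, g n x = g n y) -> x = y].
Proof.
move=> [mY cY cS S0 SD].
have [f [cf f01 fsep]] := compact_metrizable_separating mY cY.
pose dec n : nat * nat := odflt (0%N, 0%N) (unpickle n).
exists (fun n => orbit_inf S (f (dec n).1) (dec n).2), (fun n => (dec n).2.+1%:R).
split => // [n|n y|n y s t|x y E].
- exact: orbit_inf_continuous.
- exact: orbit_inf_itv.
- exact: orbit_inf_lipschitz.
apply: fsep => n; apply: (orbit_inf_separates cS S0 (cf n) (f01 n)) => k.
by have := E (pickle (n, k)); rewrite /dec pickleK.
Qed.

(** * Coordinates obtained from a test function *)

Section orbit_convolution.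
Variables (R : realType) (Y : topologicalType) (S : R -> Y -> Y) (g : Y -> R).
Local Notation mu := (@lebesgue_measure R).
Hypothesis flowS : real_flow S.
Hypotheses (cg : continuous g) (g01 : forall y, 0 <= g y <= 1).

Definition orbit_map (y : Y) (s : R) : R := g (S s y).

Lemma continuous_orbit_map y : continuous (orbit_map y).
Proof.
have [_ _ cS _ _] := flowS => s.
apply: (@continuous_comp _ _ _ (S^~ y) g); last exact: cg.
apply: (@continuous_comp _ _ _ (fun s => (s, y)) (fun p : R * Y => S p.1 p.2)).
  move=> U [[A B] /= [nA nB] AB]; apply: filterS nA => x Ax.
  by apply: AB; split => //=; exact: nbhs_singleton nB.
exact: cS.
Qed.

Lemma continuous_orbit_point s : continuous (fun y => orbit_map y s).
Proof.
have [_ _ cS _ _] := flowS => y.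
apply: (@continuous_comp _ _ _ (S s) g); last exact: cg.
apply: (@continuous_comp _ _ _ (fun y => (s, y)) (fun p : R * Y => S p.1 p.2)).
  move=> U [[A B] /= [nA nB] AB]; apply: filterS nB => x Bx.
  by apply: AB; split => //=; exact: nbhs_singleton nA.
exact: cS.
Qed.

Lemma norm_orbit_map_le1 y s : `|orbit_map y s| <= 1.
Proof. by have /andP[g0 g1] := g01 (S s y); rewrite ger0_norm. Qed.

Definition orbit_convolution (a b : R) (y : Y) : R -> R :=
  fejer_convolution (orbit_map y) a b.

Lemma orbit_convolution_shift a b y t s :
  orbit_convolution a b (S t y) s = orbit_convolution a b y (s + t).
Proof.
have [_ _ _ _ SD] := flowS.
by apply: eq_Rintegral => r _; rewrite /orbit_map -SD addrA.
Qed.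

Lemma L1_orbit_fejer a b y t :
  L1 (fun s => orbit_map y (s + t) * (cos (b * s) * fejer a s)).
Proof.
apply: (@L1Ml_bounded _ (fun s => orbit_map y (s + t)) _ 1 _ _ (L1_fejer_cos a b)).
  apply: (measurableT_comp (continuous_measurable_fun (@continuous_orbit_map y))).
  by have := measurable_affine 1 t; under eq_fun do rewrite mul1r.
by move=> s; exact: norm_orbit_map_le1.
Qed.

Lemma norm_cos_fejer_le a b s : `|cos (b * s) * fejer a s| <= fejer a s :> R.
Proof.
by rewrite normrM (ger0_norm (fejer_ge0 a s)) ler_piMl ?fejer_ge0 ?cos_max.
Qed.

Lemma orbit_convolution_continuous a b t :
  continuous (fun y => orbit_convolution a b y t).
Proof.
have [mY _ _ _ _] := flowS.
apply: (metrizable_seq_continuous mY) => y0 y_ y_cvg.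
apply: (@Rint_dominated_cvg R
  (fun n s => orbit_map (y_ n) (s + t) * (cos (b * s) * fejer a s)) _ (fejer a)).
- by move=> n; exact: L1_measurable (L1_orbit_fejer a b (y_ n) t).
- move=> s; apply: cvgM; last exact: cvg_cst.
  exact: (cvg_comp _ _ y_cvg (@continuous_orbit_point (s + t) y0)).
- exact: L1_fejer.
- move=> n s; rewrite normrM -[leRHS]mul1r ler_pM//.
    exact: norm_orbit_map_le1.
  exact: norm_cos_fejer_le.
Qed.

Lemma orbit_convolution_lipschitz (K a b : R) y t t' :
  (forall s t, `|g (S s y) - g (S t y)| <= K * `|s - t|) ->
  `|orbit_convolution a b y t - orbit_convolution a b y t'| <=
  K * `|t - t'| * \int[mu]_s fejer a s.
Proof.
move=> gK; rewrite /orbit_convolution /fejer_convolution.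
have L t := L1_orbit_fejer a b y t.
rewrite -(RintegralB measurableT (L t) (L t')) -RintegralZl//; last exact: L1_fejer.
apply: norm_Rint_le; [exact: L1B|exact/L1Z/L1_fejer|] => s.
rewrite -mulrBl normrM ler_pM//; last exact: norm_cos_fejer_le.
by apply: (le_trans (gK _ _)); rewrite opprD addrACA subrr add0r.
Qed.

(** The difference of the two orbit maps is orthogonal to all modulated kernels, so
    [fejer_separation] makes it vanish at time 0. *)
Lemma orbit_convolution_separates (a : R) y1 y2 : 0 < a ->
  (forall k : nat, orbit_convolution a (k%:R * a) y1 0 =
    orbit_convolution a (k%:R * a) y2 0) ->
  g y1 = g y2.
Proof.
move=> a0 E; have [_ _ _ S0 _] := flowS.
pose h s := orbit_map y1 s - orbit_map y2 s.
suff : h 0 = 0 by rewrite /h /orbit_map !S0 => /eqP; rewrite subr_eq0 => /eqP.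
apply: (@fejer_separation R h 2 a) => //.
- by move=> s; apply: cvgB; exact: continuous_orbit_map.
- move=> s; rewrite (le_trans (ler_normB _ _))// -[leRHS]/(1 + 1).
  by rewrite lerD ?norm_orbit_map_le1.
move=> k; move: (E k); rewrite /orbit_convolution /fejer_convolution => /eqP.
rewrite -subr_eq0 -RintegralB//; [|exact: L1_orbit_fejer|exact: L1_orbit_fejer].
move=> /eqP <-; apply: eq_Rintegral => s _.
by rewrite addr0 /h mulrBl.
Qed.

(** With P the mass of the kernel, the convolution is bounded by P and has Lipschitz constant P K.
    Dividing by P (1 + K) brings both below 1 and is legitimate even for K = 0. *)
Definition orbit_coordinate (K a b : R) (y : Y) (t : R) : R :=
  (\int[mu]_s fejer a s * (1 + K))^-1 * orbit_convolution a b y t.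

Lemma orbit_coordinate_lipschitz_ball (K a b : R) y : 0 < a -> 0 <= K ->
  (forall s t, `|g (S s y) - g (S t y)| <= K * `|s - t|) ->
  @lipschitz_ball R (orbit_coordinate K a b y).
Proof.
move=> a0 K0 gK.
have P0 : 0 < \int[mu]_s fejer a s.
  by rewrite Rint_fejer mulr_gt0 ?Rint_fejer1_gt0// gtr0_norm.
have c0 : 0 < \int[mu]_s fejer a s * (1 + K) by rewrite mulr_gt0// ltr_pwDl.
split=> [t|s t].
  rewrite -ler_norml normrM gtr0_norm ?invr_gt0// ler_pdivrMl// mulr1.
  apply: (le_trans (norm_fejer_convolution_le a b
    (@continuous_orbit_map y) (norm_orbit_map_le1 y) t)).
  by rewrite mul1r ler_peMr ?(ltW P0)// lerDl.
rewrite -mulrBr normrM gtr0_norm ?invr_gt0// ler_pdivrMl//.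
apply: (le_trans (orbit_convolution_lipschitz a b s t gK)).
rewrite [leLHS]mulrC mulrA ler_wpM2r// ler_wpM2l ?(ltW P0)//; lra.
Qed.

End orbit_convolution.

(** * The product of the band spaces *)

Section band_spaces.
Variable R : realType.

Lemma lipschitz_ball_continuous (f : R -> R) : @lipschitz_ball R f -> continuous f.
Proof.
move=> [_ Lf] x; apply/cvgrPdist_lt => e e0.
by apply: filterS (nbhsx_ballx x e e0) => y; exact: le_lt_trans (Lf x y).
Qed.

Lemma lipschitz_ball_norm_le1 (f : R -> R) t : @lipschitz_ball R f -> `|f t| <= 1.
Proof. by move=> [f1 _]; rewrite ler_norml. Qed.

Lemma band_limited_ballP (I : set R) (f : R -> R) : @lipschitz_ball R f ->
  band_limited_ball I f <-> band_limited I (fun t => (f t)%:C%C).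
Proof.
move=> Lf; split=> [[]//|bf]; split => //; first exact: lipschitz_ball_continuous.
rewrite unlock /Lnorm/=; case: ifP => _; last by rewrite lee_fin.
apply/ess_supP; apply: nearW => t /=.
by rewrite lee_fin; exact: lipschitz_ball_norm_le1.
Qed.

Lemma translate_lipschitz_ball (t : R) (f : R -> R) :
  @lipschitz_ball R f -> @lipschitz_ball R (translate t f).
Proof.
move=> [f1 Lf]; split => [s|s s']; first exact: f1.
by apply: (le_trans (Lf _ _)); rewrite opprD addrACA subrr addr0.
Qed.

Lemma translate_band_limited_lipschitz (I : set R) (t : R) (f : R -> R) :
  (band_limited_ball I `&` @lipschitz_ball R) f ->
  (band_limited_ball I `&` @lipschitz_ball R) (translate t f).
Proof.
move=> [[cf bf _] Lf]; have Ltf := translate_lipschitz_ball t Lf; split => //.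
apply/band_limited_ballP => //.
by apply: (band_limited_translate t cf _ bf) => s; exact: lipschitz_ball_norm_le1.
Qed.

Lemma compact_band_limited_lipschitz (I : set R) :
  compact (band_limited_ball I `&` @lipschitz_ball R).
Proof.
apply: compact_lipschitz_subspace => [f []//|f_ f Af f_f].
have Lf : @lipschitz_ball R f.
  split=> [t|s t].
    have cl : closed (`[-1, 1]%classic : set R) by exact: itv_closed.
    have near_t : \forall n \near \oo, `[-1, 1]%classic (f_ n t).
      by apply: nearW => n; rewrite /= in_itv/=; have [_ [h _]] := Af n.
    have := closed_cvg _ cl near_t _ (f_f t); rewrite /= in_itv/=; apply.
  have C : `|f_ n s - f_ n t| @[n --> \oo] --> `|f s - f t|.
    by apply: cvg_norm; apply: cvgB; exact: f_f.
  have near_st : \forall n \near \oo, [set x | x <= `|s - t|] `|f_ n s - f_ n t|.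
    by apply: nearW => n /=; have [_ [_ h]] := Af n.
  exact: (closed_cvg _ (@closed_le R _) near_st _ C).
split => //; apply/band_limited_ballP => //.
apply: (@band_limited_lim _ _ f_ f 1) => // n; have [[cf bf _] Ln] := Af n => //.
by move=> t; exact: lipschitz_ball_norm_le1.
Qed.

(** Rational times suffice, which keeps the separating family for the metrizability of the product
    countable. *)
Lemma lipschitz_ball_eq_rat (f g : R -> R) : @lipschitz_ball R f -> @lipschitz_ball R g ->
  (forall q : rat, f (ratr q) = g (ratr q)) -> f = g.
Proof.
move=> [_ Lf] [_ Lg] fg; apply/funext => t; apply/eqP.
rewrite -subr_eq0 -normr_le0; apply/ler_addgt0Pr => e e0; rewrite add0r.
have : t < t + e / 2 by rewrite ltrDl divr_gt0.
move=> /rat_in_itvoo[q]; rewrite in_itv/= => /andP[tq qt].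
have nq : `|t - ratr q| = ratr q - t by rewrite ltr0_norm ?subr_lt0// opprB.
have := Lf t (ratr q); have := Lg t (ratr q); rewrite fg nq.
rewrite !ler_norml; lra.
Qed.

(** With delta = (beta - alpha) / 2, the window from (k - 1) delta to (k + 1) delta belongs to the
    largest n with n alpha at most (k - 1) delta: its right end is below (n + 1) alpha + (beta -
    alpha) = n alpha + beta. *)
Lemma band_gap (alpha beta : R) : 0 < alpha -> alpha < beta ->
  exists N : nat -> nat, forall (k : nat) (eta : R), ~ band alpha beta (N k) eta ->
    (beta - alpha) / 2 <= `|k%:R * ((beta - alpha) / 2) + eta| /\
    (beta - alpha) / 2 <= `|k%:R * ((beta - alpha) / 2) - eta|.
Proof.
move=> al0 alb; set delta := (beta - alpha) / 2.
have delta0 : 0 < delta by rewrite divr_gt0// subr_gt0.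
exists (fun k => Num.truncn (k.-1%:R * delta / alpha)) => k eta.
set n := Num.truncn _ => nb.
have x0 : 0 <= k.-1%:R * delta / alpha.
  by rewrite divr_ge0 ?(ltW al0)// mulr_ge0// ltW.
have n1 : n%:R * alpha <= k.-1%:R * delta.
  by rewrite -ler_pdivlMr// truncn_le.
have n2 : k.-1%:R * delta < n%:R * alpha + alpha.
  by rewrite -[X in _ + X]mul1r -mulrDl natr1 -ltr_pdivrMr// truncnS_gt.
(* The bands are symmetric about 0, so the bound with the plus sign follows by applying [H] to
   [- eta]. *)
suff H e : ~ band alpha beta n e -> delta <= `|k%:R * delta - e|.
  split; last exact: H.
  rewrite -[X in _ + X]opprK; apply: H => -[] /=; rewrite in_itv/= => /andP[h1 h2];
    apply: nb; [right|left]; rewrite /= in_itv/=; lra.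
move=> ne; rewrite leNgt; apply/negP; rewrite ltr_norml => /andP[h1 h2].
apply: ne; clear nb; have E : beta - alpha = delta * 2 by rewrite divfK.
case: k => [|k] /= in n x0 n1 n2 h1 h2 *.
  (* For k = 0 the predecessor is 0 as well. The window from - delta to delta straddles 0 and is
     covered by the two halves of the band with index 0. *)
  have -> : n = 0%N by rewrite /n mul0r mul0r truncn0.
  have [e0|e0] := leP 0 e; [right|left]; rewrite /= in_itv/= mul0r; lra.
right; rewrite /= in_itv/=; move: h1 h2; rewrite -natr1 mulrDl mul1r; lra.
Qed.

End band_spaces.

Section band_product_flow.
Variables (R : realType) (alpha beta : R).

Lemma band_space_lipschitz n (f : band_space alpha beta n) :
  @lipschitz_ball R (\val f).
Proof. by have [] := set_mem (valP f). Qed.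

Definition band_translate n (t : R) (f : band_space alpha beta n) :
    band_space alpha beta n :=
  exist _ (translate t (\val f) : {family compact, R -> R})
    (mem_set (translate_band_limited_lipschitz t (set_mem (valP f)))).

Definition product_translate (t : R) (x : band_product alpha beta) :
    band_product alpha beta :=
  fun m n => band_translate t (x m n).

Lemma band_productP (x y : band_product alpha beta) :
  (forall m n s, (\val (x m n) : R -> R) s = (\val (y m n) : R -> R) s) -> x = y.
Proof.
move=> xy; apply: functional_extensionality_dep => m.
apply: functional_extensionality_dep => n; apply: val_inj.
by apply/funext => s; exact: xy.
Qed.

Lemma continuous_into_band_product (Z : topologicalType)
    (G : Z -> band_product alpha beta) :
  (forall m n s, continuous (fun z => (\val (G z m n) : R -> R) s)) ->
  continuous G.
Proof.
move=> cG; apply: continuous_into_prod => m; apply: continuous_into_prod => n.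
by apply: continuous_into_lipschitz => [f []//|s]; exact: cG.
Qed.

Lemma continuous_band_product_eval m n s :
  continuous (fun x : band_product alpha beta => (\val (x m n) : R -> R) s).
Proof.
move=> x; apply: (@continuous_comp _ _ _
  (fun x : band_product alpha beta => x m n)
  (fun f : band_space alpha beta n => (\val f : R -> R) s)).
  apply: (@continuous_comp _ _ _ (fun x : band_product alpha beta => x m)
    (fun y => y n)); exact: continuous_prod_eval.
exact: continuous_lipschitz_eval.
Qed.

Lemma compact_band_product : compact [set: band_product alpha beta].
Proof.
apply: compact_prod_topology => m; apply: compact_prod_topology => n.
exact/compact_set_type/compact_band_limited_lipschitz.
Qed.

Lemma metrizable_band_product : metrizable R (band_product alpha beta).
Proof.
(* [inord] makes an index out of any natural number; a number out of range merely repeats a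
   coordinate. *)
pose e (i : nat) (x : band_product alpha beta) : R :=
  if (unpickle i : option (nat * nat * rat)) is Some (m, n, q)
  then (\val (x m (inord n)) : R -> R) (ratr q) else 0.
apply: (@compact_separating_metrizable R _ e) => [i|i x|x y E|].
- rewrite /e; case: unpickle => [[[m n] q]|].
    exact: continuous_band_product_eval.
  exact: cst_continuous.
- rewrite /e; case: unpickle => [[[m n] q]|]; last by rewrite normr0.
  exact: lipschitz_ball_norm_le1 (band_space_lipschitz _).
- apply: band_productP => m n s.
  rewrite (lipschitz_ball_eq_rat (band_space_lipschitz (x m n))
    (band_space_lipschitz (y m n)))// => q.
  by have := E (pickle (m, nat_of_ord n, q)); rewrite /e pickleK inord_val.
- exact: compact_band_product.
Qed.

Lemma real_flow_product_translate : real_flow product_translate.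
Proof.
split.
- exact: metrizable_band_product.
- exact: compact_band_product.
- apply: continuous_into_band_product => m n s [t x] /=.
  apply/cvgrPdist_lt => eps eps0.
  have eps20 : 0 < eps / 2 by rewrite divr_gt0.
  have N1 : nbhs t (ball t (eps / 2)) by exact: nbhsx_ballx.
  have /cvgrPdist_lt/(_ _ eps20) N2 := @continuous_band_product_eval m n (s + t) x.
  exists (ball t (eps / 2), [set y : band_product alpha beta |
    `|(\val (x m n) : R -> R) (s + t) - (\val (y m n) : R -> R) (s + t)| < eps / 2]) => //.
  move=> [t' y] /= [tt' xy]; rewrite /translate.
  (* One half of [eps] pays for changing the point at the fixed time [s + t], the other for changing
     the time, where the Lipschitz bound is uniform in the point. *)
  have [_ Ly] := band_space_lipschitz (y m n).
  rewrite (le_lt_trans (ler_distD ((\val (y m n) : R -> R) (s + t)) _ _))//.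
  rewrite [ltRHS]splitr ltrD// (le_lt_trans (Ly _ _))//.
  by rewrite opprD addrACA subrr add0r.
- by move=> x; apply: band_productP => m n s; rewrite /= /translate addr0.
- move=> r t x; apply: band_productP => m n s.
  by rewrite /= /translate addrA.
Qed.

End band_product_flow.

(** * The embedding *)

Section embedding.
Variables (R : realType) (alpha beta : R).
Hypotheses (alpha0 : 0 < alpha) (alpha_beta : alpha < beta).
Let delta := (beta - alpha) / 2.
(** The factor [2 * pi] passes from frequencies, in which the bands are measured, to the angular
    frequencies of the cosines. *)
Let a := 2 * pi * delta.

Let delta0 : 0 < delta. Proof. by rewrite divr_gt0// subr_gt0. Qed.
Let a0 : 0 < a. Proof. by rewrite mulr_gt0// mulr_gt0// pi_gt0. Qed.

Lemma zero_band_limited_lipschitz n :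
  (band_limited_ball (band alpha beta n) `&` @lipschitz_ball R) (fun=> 0).
Proof.
have L : @lipschitz_ball R (fun=> 0).
  by split=> [t|s t]; [lra|rewrite subrr normr0].
split => //; apply/band_limited_ballP => //; apply/band_limitedP => u v su sv _.
under eq_Rintegral do rewrite -[0](mul0r 0) -mulrA.
by rewrite RintegralZl ?mul0r//; under eq_fun do rewrite mul0r; exact: integrable0.
Qed.

Lemma product_translate_universal (Y : topologicalType) (S : R -> Y -> Y) :
  real_flow S -> flow_embeds S (@product_translate R alpha beta).
Proof.
move=> flowS; have [g [K [cg g01 K0 gK gsep]]] := flow_test_functions flowS.
have [N HN] := band_gap alpha0 alpha_beta.
(* slot (m, n) carries the pair (k, j) encoded by m - n if the k-th frequency
   window lies in the n-th band, and 0 otherwise *)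
pose slot (p : nat) : nat * nat := odflt (0%N, 0%N) (unpickle p).
pose coord m (n : 'I_m.+1) y : R -> R :=
  let: (k, j) := slot (m - n)%N in
  if N k == n then orbit_coordinate S (g j) (K j) a (k%:R * a) y else fun=> 0.
have coordP m (n : 'I_m.+1) y :
    (band_limited_ball (band alpha beta n) `&` @lipschitz_ball R) (@coord m n y).
  rewrite /coord; case: (slot _) => k j; case: eqP => [<-|_]; last first.
    exact: zero_band_limited_lipschitz.
  have L : @lipschitz_ball R (orbit_coordinate S (g j) (K j) a (k%:R * a) y).
    exact: orbit_coordinate_lipschitz_ball.
  split => //; apply/band_limited_ballP => //.
  apply: (@band_limited_fejer_convolution _ _ _ 1).
  - exact: continuous_orbit_map.
  - exact: norm_orbit_map_le1.
  - exact: ltW.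
  move=> eta /HN[h1 h2]; have p0 : 0 < 2 * pi :> R by rewrite mulr_gt0 ?pi_gt0.
  have -> : k%:R * a + 2 * pi * eta = 2 * pi * (k%:R * delta + eta) by rewrite /a; ring.
  have -> : k%:R * a - 2 * pi * eta = 2 * pi * (k%:R * delta - eta) by rewrite /a; ring.
  by split; rewrite /a normrM (gtr0_norm p0) ler_pM2l.
pose phi (y : Y) : band_product alpha beta :=
  fun m n => exist _ (@coord m n y : {family compact, R -> R}) (mem_set (coordP m n y)).
exists phi; last first.
  move=> t y; apply: band_productP => m n s; rewrite /= /coord /translate.
  case: (slot _) => k j; case: ifP => // _.
  by rewrite /orbit_coordinate orbit_convolution_shift.
have [mY cY _ _ _] := flowS.
apply: compact_injective_homeomorphism => //.
- exact: metrizable_hausdorff (metrizable_band_product alpha beta).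
- apply: continuous_into_band_product => m n s; rewrite /phi/= /coord.
  case: (slot (m - n)%N) => k j; case: (N k == n) => y; last exact: cst_continuous.
  apply: cvgM; first exact: cvg_cst.
  exact: orbit_convolution_continuous.
move=> y1 y2 phi12; apply: gsep => j.
apply: (orbit_convolution_separates flowS (cg j) (g01 j) a0) => k.
(* The band [N k] occurs in every row [m] from [N k] on; in this row the offset [m - N k] is the
   code of (k, j), so the slot carries the wanted coordinate. *)
pose m := (N k + pickle (k, j))%N.
have Nm : (N k < m.+1)%N by rewrite ltnS leq_addr.
have := congr1 (fun x : band_product alpha beta =>
  (\val (x m (Ordinal Nm)) : R -> R) 0) phi12.
rewrite /= /coord /= addKn /slot pickleK /= eqxx /orbit_coordinate.
apply: mulfI; rewrite invr_eq0 gt_eqF// mulr_gt0//; last by rewrite ltr_pwDl.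
by rewrite Rint_fejer mulr_gt0 ?Rint_fejer1_gt0// normr_gt0 gt_eqF.
Qed.

End embedding.

Theorem theorem1p5 (R : realType) (alpha beta : R) :
  0 < alpha -> alpha < beta ->
  exists sigma : R -> band_product alpha beta -> band_product alpha beta,
    (forall t (x : band_product alpha beta) (m : nat) (n : 'I_m.+1),
        \val (sigma t x m n) = translate t (\val (x m n))) /\
    universal_flow sigma.
Proof.
move=> alpha0 alpha_beta; exists (@product_translate R alpha beta); split => //.
split; first exact: real_flow_product_translate.
by move=> Y S; exact: product_translate_universal.
Qed.
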